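(* Let $k$ be a field of prime characteristic $p>0$ with $[k:k^p]<\infty$, and let $R$ be the localization of a finitely generated standard graded $k$-algebra at its homogeneous maximal ideal. Then the Frobenius complexity of $R$ is finite, i.e. $\mathrm{cx}_F(R)<+\infty$.
   Context: A finitely generated standard graded $k$-algebra is a ring of the form $k[x_1,\dots,x_n]/J$ with $\deg x_i=1$ for all $i$ and $J$ a proper homogeneous ideal; its homogeneous maximal ideal is the one generated by the images of $x_1,\dots,x_n$. Complexity of a graded ring. Let $A=\bigoplus_{e\ge 0}A_e$ be a graded ring, not necessarily commutative. Let $G_e(A)$ be the subring of $A$ generated by the elements of degree at most $e$, and let $k_e(A)$ be the minimal number of homogeneous generators of $G_e(A)$ as a ring over $A_0$ (elements of $A_0$ are not counted). The complexity of $A$ is $\mathrm{cx}(A)=\inf\{n\in\mathbb{R}_{>0} : k_e(A)-k_{e-1}(A)=O(n^e) \text{ as } e\to\infty\}$ (with $\inf\emptyset=+\infty$). Frobenius operators. Let $(R,\mathfrak m,\kappa)$ be a local ring of characteristic $p$ and $M$ an $R$-module. For $e\ge 0$, ${}^eM$ denotes $M$ viewed as a left $R$-module via the $e$-th iterated Frobenius: $r\cdot m=r^{p^e}m$. Put $\mathcal F^e(M)=\operatorname{Hom}_R(M,{}^eM)$ and $\mathcal F(M)=\bigoplus_{e\ge0}\mathcal F^e(M)$, a graded ring under composition. Let $E_R(\kappa)$ be the injective hull of the residue field. The Frobenius complexity of $R$ is $\mathrm{cx}_F(R)=\log_p\big(\mathrm{cx}(\mathcal F(E_R(\kappa)))\big)$,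 where $\log_p 0=-\infty$; finiteness means that it is not $+\infty$ (the value $-\infty$ is allowed). *)

(* Defs.v *)
From HB Require Import structures.
From mathcomp Require Import all_boot all_order all_algebra.
(* mpoly has to be loaded before the mathcomp-analysis files: in the opposite
   order their notations clash. *)
From mathcomp Require Import mpoly.
From mathcomp Require Import generic_quotient ring_quotient.
From mathcomp Require Import boolp classical_sets reals ereal topology.
From mathcomp Require Import normedtype landau exp.

Set Implicit Arguments.
Unset Strict Implicit.
Unset Printing Implicit Defensive.

Import Order.TTheory GRing.Theory Num.Theory.
Import numFieldNormedType.Exports.

Local Open Scope classical_set_scope.
Local Open Scope ring_scope.

(* [k : k^p] < oo: k is spanned by finitely many elements over the subfield
   k^p of p-th powers. *)
Definition finite_p_degree (k : fieldType) (p : nat) : Prop :=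
  exists (d : nat) (b : 'I_d -> k), forall x : k,
    exists c : 'I_d -> k, x = \sum_(i < d) (c i) ^+ p * b i.

Definition homogeneous_ideal (k : fieldType) (n : nat)
    (J : idealr {mpoly k[n]}) : Prop :=
  forall f : {mpoly k[n]}, f \in J -> forall d : nat, pihomog mdeg d f \in J.

Definition homogeneous_maximal_ideal (k : fieldType) (n : nat)
    (J : idealr {mpoly k[n]}) : set {ideal_quot J} :=
  [set a | exists c : 'I_n -> {ideal_quot J},
             a = \sum_(i < n) c i * \pi_{ideal_quot J}%qT 'X_i].

(* phi exhibits R as the ring of fractions a/s with s outside the prime ideal
   m; the last clause is the usual rule a/1 = 0 iff s a = 0 for some s outside
   m (the converse implication follows from the first clause). *)
Record is_localization_at (A : comNzRingType) (m : set A) (R : comUnitRingType)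
    (phi : {rmorphism A -> R}) : Prop := IsLocalizationAt {
  localization_unit : forall s, ~ m s -> phi s \is a GRing.unit;
  localization_frac : forall r, exists a s, ~ m s /\ r = phi a / phi s;
  localization_ker : forall a, phi a = 0 -> exists s, ~ m s /\ s * a = 0
}.

(* The kernel condition says that the non-units of R form an ideal, i.e. that
   R is local, and that kappa is the quotient of R by it. *)
Record is_residue_field (R : comUnitRingType) (kappa : fieldType)
    (rho : {rmorphism R -> kappa}) : Prop := IsResidueField {
  residue_surj : forall y, exists x, rho x = y;
  residue_ker : forall x, rho x = 0 <-> x \isn't a GRing.unit
}.

(* Restriction of scalars: the S-module M seen as an R-module along f. *)
Definition restrict_scalars (R S : pzRingType) (f : {rmorphism R -> S})
  (M : lmodType S) : Type := M.

Section RestrictScalars.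
Variables (R S : pzRingType) (f : {rmorphism R -> S}) (M : lmodType S).

HB.instance Definition _ := GRing.Zmodule.on (restrict_scalars f M).

Definition restrict_scale (r : R) (x : restrict_scalars f M) :
  restrict_scalars f M := f r *: (x : M).

Lemma restrict_scaleA a b x :
  restrict_scale a (restrict_scale b x) = restrict_scale (a * b) x.
Proof. by rewrite /restrict_scale rmorphM scalerA. Qed.

Lemma restrict_scale1 : left_id 1 restrict_scale.
Proof. by move=> x; rewrite /restrict_scale rmorph1 scale1r. Qed.

Lemma restrict_scaleDr : right_distributive restrict_scale +%R.
Proof. by move=> a x y; rewrite /restrict_scale scalerDr. Qed.

Lemma restrict_scaleDl x : {morph restrict_scale^~ x : a b / a + b}.
Proof. by move=> a b; rewrite /restrict_scale rmorphD scalerDl. Qed.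

HB.instance Definition _ := GRing.Zmodule_isLmodule.Build R
  (restrict_scalars f M)
  restrict_scaleA restrict_scale1 restrict_scaleDr restrict_scaleDl.

End RestrictScalars.

Definition injective_module (R : comNzRingType) (E : lmodType R) : Prop :=
  forall (M N : lmodType R) (i : {linear M -> N}) (f : {linear M -> E}),
    injective i -> exists g : {linear N -> E}, forall x, g (i x) = f x.

Definition is_submodule (R : comNzRingType) (E : lmodType R) (N : set E)
    : Prop :=
  N 0 /\ forall (a : R) x y, N x -> N y -> N (a *: x + y).

Definition essential_extension (R : comNzRingType) (M E : lmodType R)
    (i : {linear M -> E}) : Prop :=
  injective i /\
  forall N : set E, is_submodule N -> N `&` range i = [set 0] -> N = [set 0].

Definition is_injective_hull (R : comNzRingType) (M E : lmodType R)
    (i : {linear M -> E}) : Prop :=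
  injective_module E /\ essential_extension i.

Section Graded.

Definition is_subring (A : pzRingType) (S : set A) : Prop :=
  [/\ S 1, forall x y, S x -> S y -> S (x - y)
         & forall x y, S x -> S y -> S (x * y)].

Definition subring_generated (A : pzRingType) (X : set A) : set A :=
  smallest (@is_subring A) X.

Record gradedRing := GradedRing {
  graded_sort :> pzRingType;
  degree_part : nat -> set graded_sort;
  degree_part0 : forall e, degree_part e 0;
  degree_partB : forall e x y,
    degree_part e x -> degree_part e y -> degree_part e (x - y);
  degree_part1 : degree_part 0%N 1;
  degree_partM : forall d e x y,
    degree_part d x -> degree_part e y -> degree_part (d + e)%N (x * y);
  graded_span : forall x, exists (N : nat) (c : nat -> graded_sort),
    (forall e, degree_part e (c e)) /\ x = \sum_(e < N) c e;
  graded_direct : forall (N : nat) (c : nat -> graded_sort),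
    (forall e, degree_part e (c e)) -> \sum_(e < N) c e = 0 ->
    forall e, (e < N)%N -> c e = 0
}.

Variable A : gradedRing.

Definition homogeneous_elt (a : A) : Prop := exists e, degree_part e a.

Definition low_degree_subring (e : nat) : set A :=
  subring_generated [set a | exists i, (i <= e)%N /\ degree_part i a].

Definition homogeneous_generators (e : nat) (s : seq A) : Prop :=
  (forall a, a \in s -> homogeneous_elt a) /\
  subring_generated (degree_part 0%N `|` [set` s]) = low_degree_subring e.

(* No m satisfies this when low_degree_subring e is not finitely generated
   over the degree 0 part. *)
Definition min_generators (e m : nat) : Prop :=
  (exists s : seq A, homogeneous_generators e s /\ size s = m) /\
  forall s : seq A, homogeneous_generators e s -> (m <= size s)%N.

(* When some low_degree_subring e is not finitely generated, the growth condition is unsatisfied, so that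
   the complexity is the infimum of the empty set, +oo. *)
Definition complexity (RR : realType) : \bar RR :=
  ereal_inf [set x%:E | x in [set x : RR | 0 < x /\
    exists k : nat -> nat, (forall e, min_generators e (k e)) /\
      (fun e => (k e)%:R - (k e.-1)%:R : RR) =O_\oo (fun e => x ^+ e : RR)]].

End Graded.

Section Frobenius.
Variables (R : comNzRingType) (p : nat) (charRp : p \in [pchar R]).

Definition iter_frobenius of p \in [pchar R] :=
  fun (e : nat) (r : R) => r ^+ (p ^ e).

Lemma iter_frobenius_zmod e : zmod_morphism (iter_frobenius charRp e).
Proof.
move=> x y; rewrite /iter_frobenius.
have pn : [pchar R].-nat (p ^ e)%N.
  by rewrite (eq_pnat _ (pcharf_eq charRp)) pnatX pnat_id ?(pcharf_prime charRp).
by rewrite -[X in _ = X ^+ _ - _](subrK y) [in RHS]exprDn_pchar // addrK.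
Qed.

Lemma iter_frobenius_monoid e : monoid_morphism (iter_frobenius charRp e).
Proof.
by split=> [|x y]; rewrite /iter_frobenius ?expr1n ?exprMn.
Qed.

HB.instance Definition _ e := GRing.isZmodMorphism.Build R R
  (iter_frobenius charRp e) (iter_frobenius_zmod e).
HB.instance Definition _ e := GRing.isMonoidMorphism.Build R R
  (iter_frobenius charRp e) (iter_frobenius_monoid e).

Variable M : lmodType R.

Definition frobenius_twist (e : nat) : lmodType R :=
  restrict_scalars (iter_frobenius charRp e) M.

(* Hom_R(M, ^eM), as a set of maps M -> M: since ^eM has the same underlying
   group as M, these maps can be composed. *)
Definition frobenius_operator (e : nat) : set (M -> M) :=
  [set f | linear (f : M -> frobenius_twist e)].

(* The elements of the direct sum over e of the Hom_R(M, ^eM): finitely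
   supported families. Composition extends to the product fmul below. *)
Record frobenius_ops := FrobeniusOps {
  fcoef :> nat -> M -> M;
  fcoef_linear : forall e, frobenius_operator e (fcoef e);
  fcoef_finite : exists N : nat, forall e, (N <= e)%N -> forall x, fcoef e x = 0
}.


Lemma frobenius_operatorP e (f : M -> M) : frobenius_operator e f <->
  forall (a : R) x y, f (a *: x + y) = a ^+ (p ^ e) *: f x + f y.
Proof. by []. Qed.

Lemma frobenius_opsP (f g : frobenius_ops) : (forall e x, f e x = g e x) -> f = g.
Proof.
case: f g => f fl ff [g gl gf] /= fg.
have {}fg : f = g by apply/funext => e; apply/funext => x; exact: fg.
by subst g; congr FrobeniusOps; exact: Prop_irrelevance.
Qed.

HB.instance Definition _ := gen_eqMixin frobenius_ops.
HB.instance Definition _ := gen_choiceMixin frobenius_ops.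

Lemma fcoef_zmod (f : frobenius_ops) e : zmod_morphism (f e).
Proof.
move=> x y; have /frobenius_operatorP fl := fcoef_linear f e.
have := fl 1 (x - y) y; rewrite expr1n !scale1r subrK => ->.
by rewrite addrK.
Qed.

HB.instance Definition _ (f : frobenius_ops) e :=
  GRing.isZmodMorphism.Build M M (fcoef f e) (fcoef_zmod f e).

Lemma fcoefZ (f : frobenius_ops) e a x : f e (a *: x) = a ^+ (p ^ e) *: f e x.
Proof.
have /frobenius_operatorP fl := fcoef_linear f e.
by have := fl a x 0; rewrite raddf0 !addr0.
Qed.

Lemma fcoefD (f : frobenius_ops) e x y : f e (x + y) = f e x + f e y.
Proof. exact: raddfD. Qed.

Lemma fcoefx0 (f : frobenius_ops) e : f e 0 = 0.
Proof. exact: raddf0. Qed.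

Program Definition fzero := @FrobeniusOps (fun _ _ => 0) _ _.
Next Obligation. by move=> e; apply/frobenius_operatorP => a x y; rewrite scaler0 addr0. Qed.
Next Obligation. by exists 0%N. Qed.

Program Definition fopp (f : frobenius_ops) := @FrobeniusOps (fun e x => - f e x) _ _.
Next Obligation.
move=> f e; apply/frobenius_operatorP => a x y.
by rewrite fcoefD fcoefZ opprD scalerN.
Qed.
Next Obligation.
by move=> f; have [N fN] := fcoef_finite f; exists N => e /fN h x; rewrite h oppr0.
Qed.

Program Definition fadd (f g : frobenius_ops) :=
  @FrobeniusOps (fun e x => f e x + g e x) _ _.
Next Obligation.
move=> f g e; apply/frobenius_operatorP => a x y.
by rewrite !fcoefD !fcoefZ scalerDr addrACA.
Qed.
Next Obligation.
move=> f g; have [N fN] := fcoef_finite f; have [N' gN] := fcoef_finite g.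
exists (maxn N N') => e; rewrite geq_max => /andP[/fN h /gN h'] x.
by rewrite h h' addr0.
Qed.

Program Definition fone :=
  @FrobeniusOps (fun e x => if e == 0%N then x else 0) _ _.
Next Obligation.
move=> [|e]; apply/frobenius_operatorP => a x y /=; first by rewrite expr1.
by rewrite scaler0 addr0.
Qed.
Next Obligation. by exists 1%N => -[]. Qed.

Program Definition fmul (f g : frobenius_ops) :=
  @FrobeniusOps (fun e x => \sum_(i < e.+1) f i (g (e - i)%N x)) _ _.
Next Obligation.
move=> f g e; apply/frobenius_operatorP => a x y.
rewrite scaler_sumr -big_split; apply: eq_bigr => i _ /=.
rewrite !fcoefD !fcoefZ -exprM -expnD subnK //.
by rewrite -ltnS.
Qed.
Next Obligation.
move=> f g; have [N fN] := fcoef_finite f; have [N' gN] := fcoef_finite g.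
exists (N + N')%N => e Ne x; apply: big1 => i _.
have [/fN -> //|iN] := leqP N i.
rewrite gN ?fcoefx0 // leq_subRL; last by rewrite -ltnS.
by apply: leq_trans Ne; rewrite leq_add2r ltnW.
Qed.

Lemma faddA : associative fadd.
Proof. by move=> f g h; apply: frobenius_opsP => e x /=; rewrite addrA. Qed.

Lemma faddC : commutative fadd.
Proof. by move=> f g; apply: frobenius_opsP => e x /=; rewrite addrC. Qed.

Lemma fadd0 : left_id fzero fadd.
Proof. by move=> f; apply: frobenius_opsP => e x /=; rewrite add0r. Qed.

Lemma faddN : left_inverse fzero fopp fadd.
Proof. by move=> f; apply: frobenius_opsP => e x /=; rewrite addNr. Qed.

HB.instance Definition _ :=
  GRing.isZmodule.Build frobenius_ops faddA faddC fadd0 faddN.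

Lemma sum_shift (F : nat -> M) n i : (i <= n)%N ->
  \sum_(j < (n - i).+1) F (i + j)%N = \sum_(m < n.+1 | (i <= m)%N) F m.
Proof.
move=> le_in; rewrite -(big_mkord xpredT (fun j => F (i + j)%N)) -subSn //.
rewrite -(big_mkord (leq i)) [RHS](big_cat_nat (n := i)) ?leqW //=.
rewrite [X in _ = X + _]big_nat_cond [X in _ = X + _]big1.
  rewrite add0r -[X in \big[_/_]_(X <= _ < n.+1 | _) _]add0n big_addn; apply: congr_big_nat => // j.
    by rewrite leq_addl.
  by rewrite addnC.
by move=> m /andP[/andP[_ mi] im]; rewrite leqNgt mi in im.
Qed.

Lemma fmulA : associative fmul.
Proof.
move=> f g h; apply: frobenius_opsP => n x /=.
pose F i m := f i (g (m - i)%N (h (n - m)%N x)).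
transitivity (\sum_(i < n.+1) \sum_(m < n.+1 | (i <= m)%N) F i m).
  apply: eq_bigr => i _; rewrite -sum_shift; last by rewrite -ltnS.
  rewrite raddf_sum; apply: eq_bigr => j _ /=.
  by rewrite /F addKn subnDA.
rewrite (exchange_big_dep xpredT) //=; apply: eq_bigr => m _.
rewrite (big_ord_widen n.+1 (fun i => F i m)) //.
Qed.

Lemma fmul1 : left_id fone fmul.
Proof.
move=> f; apply: frobenius_opsP => e x /=.
by rewrite big_ord_recl /= subn0 big1 ?addr0.
Qed.

Lemma fmulr1 : right_id fone fmul.
Proof.
move=> f; apply: frobenius_opsP => e x /=.
rewrite big_ord_recr /= subnn big1 ?add0r // => i _.
by rewrite subn_eq0 leqNgt ltn_ord fcoefx0.
Qed.

Lemma fmulDl : left_distributive fmul fadd.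
Proof. by move=> f g h; apply: frobenius_opsP => e x /=; rewrite big_split. Qed.

Lemma fmulDr : right_distributive fmul fadd.
Proof.
move=> f g h; apply: frobenius_opsP => e x /=.
by rewrite -big_split; apply: eq_bigr => i _; rewrite fcoefD.
Qed.

HB.instance Definition _ := GRing.Zmodule_isPzRing.Build frobenius_ops
  fmulA fmul1 fmulr1 fmulDl fmulDr.

Definition frobenius_part (e : nat) : set frobenius_ops :=
  [set f | forall i x, i != e -> f i x = 0].

Lemma fcoef0 e x : (0 : frobenius_ops) e x = 0. Proof. by []. Qed.

Lemma fcoef_sum N (c : nat -> frobenius_ops) e x :
  (\sum_(i < N) c i) e x = \sum_(i < N) c i e x.
Proof.
by elim/big_rec2: _ => // i y f _ <-.
Qed.

Lemma frobenius_partB e f g :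
  frobenius_part e f -> frobenius_part e g -> frobenius_part e (f - g).
Proof.
by move=> fe ge i x ie; rewrite [LHS](_ : _ = f i x - g i x) // fe ?ge ?subr0.
Qed.

Lemma frobenius_part1 : frobenius_part 0%N 1.
Proof. by case. Qed.

Lemma frobenius_partM d e f g : frobenius_part d f -> frobenius_part e g ->
  frobenius_part (d + e)%N (f * g).
Proof.
move=> fd ge n x nde; rewrite [LHS](_ : _ = \sum_(i < n.+1) f i (g (n - i)%N x)) //.
apply: big1 => i _; have [id|] := eqVneq (i : nat) d; last exact: fd.
rewrite ge ?fcoefx0 //; apply: contra nde => /eqP <-.
by rewrite -id subnKC // -ltnS.
Qed.

Program Definition fcomponent (f : frobenius_ops) (e : nat) :=
  @FrobeniusOps (fun i x => if i == e then f i x else 0) _ _.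
Next Obligation.
move=> f e i; have [->|_] := eqVneq i e; first exact: (fcoef_linear f e).
by apply/frobenius_operatorP => a x y; rewrite scaler0 addr0.
Qed.
Next Obligation.
by move=> f e; exists e.+1 => i ei x; rewrite gtn_eqF.
Qed.

Lemma frobenius_span f : exists (N : nat) (c : nat -> frobenius_ops),
  (forall e, frobenius_part e (c e)) /\ f = \sum_(e < N) c e.
Proof.
have [N fN] := fcoef_finite f; exists N, (fcomponent f); split.
  by move=> e i x /negPf /= ->.
apply: frobenius_opsP => e x; rewrite fcoef_sum /=.
have [eN|/fN ->] := ltnP e N.
  rewrite (bigD1 (Ordinal eN)) //= eqxx big1 ?addr0 // => i ie.
  by case: eqP => // ei; move: ie; rewrite -val_eqE /= ei eqxx.
by rewrite big1 // => i _; case: ifP.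
Qed.

Lemma frobenius_direct N (c : nat -> frobenius_ops) :
  (forall e, frobenius_part e (c e)) -> \sum_(e < N) c e = 0 ->
  forall e, (e < N)%N -> c e = 0.
Proof.
move=> ce c0 e eN; apply: frobenius_opsP => i x; rewrite fcoef0.
have [->|] := eqVneq i e; last exact: ce.
have := fcoef_sum N c e x; rewrite c0 fcoef0 (bigD1 (Ordinal eN)) //= big1.
  by rewrite addr0 => <-.
by move=> j je; apply: ce; move: je; rewrite -val_eqE eq_sym.
Qed.

Definition frobenius_ring : gradedRing :=
  @GradedRing frobenius_ops frobenius_part (fun _ _ _ _ => erefl)
    frobenius_partB frobenius_part1 frobenius_partM
    frobenius_span frobenius_direct.

(* For R local and M the injective hull of its residue field, this is the
   Frobenius complexity of R: the base-p logarithm of the complexity of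
   frobenius_ring, with value -oo at 0. *)
Definition frobenius_complexity (RR : realType) : \bar RR :=
  (lne (complexity frobenius_ring RR) * ((ln (p%:R : RR))^-1)%:E)%E.

End Frobenius.

Lemma pchar_transport (k : fieldType) (p n : nat) (J : idealr {mpoly k[n]})
    (R : comNzRingType) (phi : {rmorphism {ideal_quot J} -> R}) :
  p \in [pchar k] -> p \in [pchar R].
Proof.
move=> kp; apply: (rmorph_pchar phi).
apply: (rmorph_pchar (\pi_{ideal_quot J}%qT)).
exact: (rmorph_pchar (@mpolyC n k)).
Qed.

(* Main.v *)
Require Import Defs.
From HB Require Import structures.
From mathcomp Require Import all_boot all_order all_algebra.
From mathcomp Require Import mpoly.
From mathcomp Require Import generic_quotient ring_quotient.
From mathcomp Require Import boolp classical_sets reals ereal topology.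
From mathcomp Require Import normedtype landau exp.
From mathcomp Require Import functions ssrcomplements zify ring.

(** Let S = k[x_1, ..., x_n], let f_1, ..., f_r be homogeneous generators of J,
    and q = p^e. Operators of degree 0 are free of charge in the definition of the
    complexity, so it suffices to show that the Frobenius
    operators of degree e on E are generated by at most (C q)^c of them as a left
    module over the operators of degree 0, where C and c do not depend on e: then
    k_e is at most exponential in e.

    Concretely, E is the space of inverse polynomials annihilated by J: functions
    d of finite support on the monomials, on which S acts by contraction
    ([to_dual_inj] and [to_dual_surj], Macaulay's description of the hull). On
    inverse polynomials there is a Frobenius map F with F(s d) = s^q F(d). If s
    belongs to the colon ideal of J^[q] = (f_1^q, ..., f_r^q) by J, then
    x |-> s F(x) is a Frobenius operator on E, because J s F(x) is contained in
    J^[q] F(x), which is zero. Let (s_l, c_l), for l < g, generate the module of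
    all solutions of f_i s + sum_j c_ij f_j^q = 0. The operators s_l F generate:

    - Every operator h of degree e factors as an S-linear map after F. The inverse
      polynomials annihilated by J^[q] form a module K', which is the base change
      of E along the Frobenius endomorphism of S, since S is free over its q-th
      powers (this is where [k : k^p] is finite). So h extends to an S-linear map
      from K' to E ([lifts] and its lemmas), which kills J K' since J kills E.
    - An element d of K' with s_l d = 0 for all l lies in J K'
      ([colon_exactness]). This is the k-dual of the exactness of
      S^g -> S^(1 + r^2) -> S^r; duals stay within finitely supported functions
      because the matrix is homogeneous ([dual_exactness]).
    - Hence d |-> (s_l d)_l embeds K' / J K' into E^g. As E is injective, the map
      on K' / J K' extends to E^g, and its components h_l satisfy
      h = sum_l h_l o (s_l F) ([frobenius_operators_generated]).

    It remains to bound g. For a matrix over k[x_1, ..., x_n] whose numbers of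
    rows and columns and whose degrees are at most T, the kernel has at most T^c
    generators, with c depending on n only ([kernel_generators_polynomial]). This
    is Hermann's elimination: after a change of variables a maximal minor becomes
    monic in one variable; modulo the syzygies given by Cramer's rule every
    solution has bounded degree in that variable, and its coefficients solve a
    polynomially larger system in the other variables. *)

Set Implicit Arguments.
Unset Strict Implicit.
Unset Printing Implicit Defensive.

Import Order.TTheory GRing.Theory Num.Theory.
Import numFieldNormedType.Exports.

Local Open Scope classical_set_scope.
Local Open Scope ring_scope.

(** * Kernels of matrices over a domain *)

(** Over the fraction field, choose rows that form a basis of the row space and
    then columns that make the chosen rows invertible; the remaining equations are
    combinations of the chosen ones. *)
Lemma nonzero_maximal_minor (A : idomainType) (I J : finType) (M : I -> J -> A) :
  exists r (f : 'I_r -> I) (g : 'I_r -> J),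
  [/\ (r <= #|I|)%N,
      \det (\matrix_(a, b) M (f a) (g b)) != 0 &
      forall v : J -> A, (forall a, \sum_j M (f a) j * v j = 0) ->
        forall i, \sum_j M i j * v j = 0].
Proof.
pose MF : 'M[{fraction A}]_(#|I|, #|J|) :=
  \matrix_(i, j) FracField.tofrac (M (enum_val i) (enum_val j)).
pose N := rowsub (maxrankfun MF) MF.
have fullN : row_full N^T by rewrite /row_full mxrank_tr; exact: maxrowsub_free.
exists (\rank MF), (enum_val \o maxrankfun MF), (enum_val \o fullrankfun fullN).
split; first exact: rank_leq_row.
  have : rowsub (fullrankfun fullN) N^T \in unitmx.
    by rewrite -row_full_unit fullrowsub_full.
  rewrite unitmxE unitfE -det_tr.
  suff -> : (rowsub (fullrankfun fullN) N^T)^T =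
    map_mx (@FracField.tofrac A) (\matrix_(a, b) M (enum_val (maxrankfun MF a))
                          (enum_val (fullrankfun fullN b))).
    by rewrite det_map_mx tofrac_eq0.
  by apply/matrixP => a b; rewrite !mxE.
move=> v Mv i; pose w : 'cV[{fraction A}]_#|J| := \col_j FracField.tofrac (v (enum_val j)).
have mulw m (h : 'I_m -> 'I_#|I|) a :
    (rowsub h MF *m w) a 0 = FracField.tofrac (\sum_j M (enum_val (h a)) j * v j).
  rewrite mxE rmorph_sum (reindex (@enum_val _ (mem J))) /=; last first.
    by apply: onW_bij; exact: enum_val_bij.
  by apply: eq_bigr => j _; rewrite !mxE rmorphM.
have Nw : N *m w = 0.
  by apply/matrixP => a b; rewrite ord1 mulw Mv mxE rmorph0.
have : MF *m w = 0.
  have /submxP[D ->] : (MF <= N)%MS by rewrite eq_maxrowsub.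
  by rewrite -mulmxA Nw mulmx0.
move/matrixP/(_ (enum_rank i) 0); rewrite -[X in (X *m _) _ _](mxsub_id MF).
rewrite mulw /= enum_rankK mxE => /eqP.
by rewrite tofrac_eq0 => /eqP.
Qed.

Definition in_kernel (A : comNzRingType) (I J : finType) (M : I -> J -> A)
    (v : J -> A) : Prop :=
  forall i, \sum_j M i j * v j = 0.

(** The index type of the generators is an arbitrary finite type, so that families
    of generators can be juxtaposed by a sum type. *)
Definition kernel_generators (A : comNzRingType) (I J : finType)
    (M : I -> J -> A) (g : nat) : Prop :=
  exists (L : finType) (G : L -> J -> A),
    [/\ (#|L| <= g)%N, forall l, in_kernel M (G l) &
        forall v, in_kernel M v ->
          exists a : L -> A, forall j, v j = \sum_l a l * G l j].

Lemma kernel_generatorsW (A : comNzRingType) (I J : finType)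
    (M : I -> J -> A) (g g' : nat) :
  (g <= g')%N -> kernel_generators M g -> kernel_generators M g'.
Proof.
move=> gg' [L [G [Lg MG Gv]]]; exists L, G; split=> //; exact: leq_trans gg'.
Qed.

Section Cramer.
Variables (A : comNzRingType) (I J : finType) (M : I -> J -> A).
Variables (r : nat) (f : 'I_r -> I) (g : 'I_r -> J).
Let Q := \matrix_(a, b) M (f a) (g b).
Hypothesis extend_kernel : forall v : J -> A,
  (forall a, \sum_j M (f a) j * v j = 0) -> in_kernel M v.

(** The vector adj(Q) x, placed at the columns [g] of the minor and extended by
    zero. *)
Definition cramer_correction (x : 'I_r -> A) (j : J) : A :=
  \sum_b (j == g b)%:R * \sum_a (\adj Q) b a * x a.

(** For [j] outside the minor, Cramer's rule solves the chosen equations for the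
    variables of the minor, when the [j]-th variable is det Q and the others are 0. *)
Definition cramer_syzygy (j : J) : J -> A := fun j' =>
  \det Q * (j' == j)%:R - cramer_correction (fun a => M (f a) j) j'.

Lemma row_cramer_correction x a :
  \sum_j M (f a) j * cramer_correction x j = \det Q * x a.
Proof.
transitivity (\sum_b Q a b * \sum_a' (\adj Q) b a' * x a').
  rewrite (eq_bigr (fun j => \sum_b M (f a) j * ((j == g b)%:R *
     \sum_a' (\adj Q) b a' * x a'))); last by move=> j _; rewrite mulr_sumr.
  rewrite exchange_big /=; apply: eq_bigr => b _.
  rewrite (bigD1 (g b)) //= eqxx mul1r [X in _ + X]big1 ?addr0 ?mxE // => j /negPf ->.
  by rewrite mul0r mulr0.
transitivity ((Q *m (\adj Q *m \col_a' x a')) a 0).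
  rewrite mxE; apply: eq_bigr => b _; congr (_ * _); rewrite mxE.
  by apply: eq_bigr => a' _; rewrite !mxE.
by rewrite mulmxA mul_mx_adj mul_scalar_mx !mxE.
Qed.

Lemma in_kernel_cramer_syzygy j : in_kernel M (cramer_syzygy j).
Proof.
apply: extend_kernel => a.
under eq_bigr do rewrite /cramer_syzygy mulrBr.
rewrite sumrB row_cramer_correction (bigD1 j) //= eqxx mulr1 big1 ?addr0.
  by rewrite mulrC subrr.
by move=> j' /negPf ->; rewrite !mulr0.
Qed.

Lemma cramer_correction_sum (v : J -> A) j :
  cramer_correction (fun a => \sum_l M (f a) l * v l) j =
  \sum_l v l * cramer_correction (fun a => M (f a) l) j.
Proof.
rewrite /cramer_correction.
under [RHS]eq_bigr do rewrite mulr_sumr.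
rewrite exchange_big /=; apply: eq_bigr => b _.
under [RHS]eq_bigr do rewrite mulrCA.
rewrite -mulr_sumr; congr (_ * _).
under [RHS]eq_bigr do rewrite mulr_sumr.
rewrite exchange_big /=; apply: eq_bigr => a _.
rewrite mulr_sumr; apply: eq_bigr => l _; ring.
Qed.

Lemma in_kernelB (v w : J -> A) :
  in_kernel M v -> in_kernel M w -> in_kernel M (fun j => v j - w j).
Proof.
move=> Mv Mw i; under eq_bigr do rewrite mulrBr.
by rewrite sumrB Mv Mw subrr.
Qed.

Lemma in_kernel_sum (L : finType) (u : L -> A) (c : L -> J -> A) :
  (forall l, in_kernel M (c l)) -> in_kernel M (fun j => \sum_l u l * c l j).
Proof.
move=> Mc i; under eq_bigr do rewrite mulr_sumr.
rewrite exchange_big /= big1 // => l _.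
under eq_bigr do rewrite mulrCA.
by rewrite -mulr_sumr Mc mulr0.
Qed.

(** Modulo the Cramer syzygies the coordinates of a solution matter only modulo
    det Q, and the coordinates [w] that remain determine the reduced solution up to
    division by det Q. The second formula is what bounds its degree. *)
Lemma cramer_reduction (v u w : J -> A) : in_kernel M v ->
    (forall j, v j = \det Q * u j + w j) ->
  let y := fun j => v j - \sum_l u l * cramer_syzygy l j in
  in_kernel M y /\
  forall j, \det Q * (y j - w j) =
    - cramer_correction (fun a => \sum_l M (f a) l * w l) j.
Proof.
move=> Mv vE y; split.
  apply: in_kernelB => //; apply: in_kernel_sum => l.
  exact: in_kernel_cramer_syzygy.
move=> j.
have yE : y j - w j = \sum_l u l * cramer_correction (fun a => M (f a) l) j.
  rewrite /y vE /cramer_syzygy.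
  under eq_bigr do rewrite mulrBr.
  rewrite sumrB (bigD1 j) //= eqxx mulr1 big1 ?addr0; first by ring.
  by move=> l; rewrite eq_sym => /negPf ->; rewrite !mulr0.
have /eqP : \sum_l (v l - w l + w l) * cramer_correction (fun a => M (f a) l) j = 0.
  under eq_bigr do rewrite subrK.
  rewrite -cramer_correction_sum /cramer_correction big1 // => b _.
  rewrite big1 ?mulr0 // => a _; rewrite Mv mulr0 //.
under eq_bigr do rewrite mulrDl.
rewrite big_split /= cramer_correction_sum addr_eq0 => /eqP <-.
rewrite yE mulr_sumr; apply: eq_bigr => l _.
by rewrite vE addrK mulrA.
Qed.

End Cramer.

(** * A change of variables that makes a polynomial monic *)

Lemma mpoly_rmorphism_ext (R : nzRingType) (S : comNzRingType) (n : nat)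
    (f g : {rmorphism {mpoly R[n]} -> S}) :
  (forall c, f c%:MP = g c%:MP) -> (forall i, f 'X_i = g 'X_i) -> f =1 g.
Proof.
move=> fgC fgX p; rewrite (mpolyE p) !rmorph_sum; apply: eq_bigr => m _ /=.
rewrite -mul_mpolyC !rmorphM /= fgC; congr (_ * _).
rewrite mpolyXE_id !rmorph_prod; apply: eq_bigr => i _.
by rewrite !rmorphXn /= fgX.
Qed.

(** This is uniqueness of base [B] digits, read from the lowest one. *)
Lemma radix_inj (B n : nat) (a b : 'I_n -> nat) :
  (forall i, a i < B)%N -> (forall i, b i < B)%N ->
  (\sum_i a i * B ^ i = \sum_i b i * B ^ i)%N -> a =1 b.
Proof.
elim: n a b => [|n IHn] a b aB bB; first by move=> _ [].
rewrite !big_ord_recl /= !muln1.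
have shift (c : 'I_n.+1 -> nat) : (\sum_(i < n) c (lift ord0 i) * B ^ bump 0 i =
    (\sum_(i < n) c (lift ord0 i) * B ^ i) * B)%N.
  by rewrite big_distrl; apply: eq_bigr => i _ /=; rewrite /bump add1n expnSr mulnA.
rewrite !shift addnC [X in _ = X]addnC => E.
have B0 : (0 < B)%N by apply: leq_ltn_trans (aB ord0).
have a0 : a ord0 = b ord0.
  by move: (congr1 (modn^~ B) E); rewrite !modnMDl !modn_small.
move: E; rewrite a0 => /addIn/eqP; rewrite eqn_pmul2r // => /eqP E i.
case: (unliftP ord0 i) => [j ->|->] //.
exact: (IHn (fun j => a (lift ord0 j)) (fun j => b (lift ord0 j))).
Qed.

Section Shear.
Variables (k : fieldType) (n B : nat).
Hypothesis B_gt0 : (0 < B)%N.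
Local Notation S := {mpoly k[n.+1]}.
Local Notation T := {poly {mpoly k[n]}}.

(** The substitution x_0 |-> X, x_i |-> x_{i-1} + X^(B^i). Distinct monomials with
    exponents below [B] acquire distinct degrees in X, by uniqueness of base [B]
    digits, so that one of them dominates. It works over finite fields too, where a
    linear change of variables need not exist. *)
Definition shear_var (i : 'I_n.+1) : T :=
  (if unlift ord0 i is Some j then ('X_j)%:P else 0) + 'X^(B ^ i).

Definition shear : S -> T := mmap (polyC \o @mpolyC n k) shear_var.
HB.instance Definition _ := GRing.RMorphism.on shear.

(** The inverse substitution, first on the coefficients and then on X. *)
Definition unshear_coef : {mpoly k[n]} -> S :=
  mmap (@mpolyC n.+1 k) (fun j => 'X_(lift ord0 j) - 'X_ord0 ^+ (B ^ j.+1)).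
HB.instance Definition _ := GRing.RMorphism.on unshear_coef.

Definition unshear (p : T) : S := (map_poly unshear_coef p).['X_ord0].

Lemma unshear_is_zmod_morphism : zmod_morphism unshear.
Proof. by move=> p q; rewrite /unshear rmorphB hornerD hornerN. Qed.
Lemma unshear_is_monoid_morphism : monoid_morphism unshear.
Proof.
by split=> [|p q]; rewrite /unshear ?rmorph1 ?hornerC // rmorphM hornerM.
Qed.
HB.instance Definition _ :=
  GRing.isZmodMorphism.Build T S unshear unshear_is_zmod_morphism.
HB.instance Definition _ :=
  GRing.isMonoidMorphism.Build T S unshear unshear_is_monoid_morphism.

Lemma shearC c : shear c%:MP = c%:MP%:P.
Proof. by rewrite /shear mmapC. Qed.

Lemma shearXU i : shear 'X_i = shear_var i.
Proof. by rewrite /shear mmapX mmap1U. Qed.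

Lemma unshearX : unshear 'X = 'X_ord0.
Proof. by rewrite /unshear map_polyX hornerX. Qed.

Lemma unshearC (p : {mpoly k[n]}) : unshear p%:P = unshear_coef p.
Proof. by rewrite /unshear map_polyC hornerC. Qed.

Lemma shearK : cancel shear unshear.
Proof.
apply: (@mpoly_rmorphism_ext k S n.+1 (unshear \o shear) idfun) => [c|i] /=.
  by rewrite shearC unshearC /unshear_coef mmapC.
rewrite shearXU /shear_var; case: (unliftP ord0 i) => [j ->|->].
  rewrite rmorphD /= unshearC rmorphXn /= unshearX.
  by rewrite /unshear_coef mmapX mmap1U subrK.
by rewrite add0r expn0 expr1 unshearX.
Qed.

Lemma unshearK : cancel unshear shear.
Proof.
have constK (p : {mpoly k[n]}) : shear (unshear_coef p) = p%:P.
  apply: (@mpoly_rmorphism_ext k T n (shear \o unshear_coef) polyC) => [c|i] /=.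
    by rewrite /unshear_coef mmapC shearC.
  rewrite /unshear_coef mmapX mmap1U rmorphB rmorphXn /= !shearXU /shear_var.
  by rewrite liftK unlift_none add0r expn0 expr1 addrK.
move=> p; rewrite -{1}[p]coefK -[RHS]coefK !poly_def !rmorph_sum.
apply: eq_bigr => i _ /=.
rewrite -mul_polyC !rmorphM !rmorphXn /= unshearC constK unshearX shearXU.
by rewrite /shear_var unlift_none add0r expn0 expr1.
Qed.

Definition weight (m : 'X_{1..n.+1}) : nat := (\sum_i m i * B ^ i)%N.

Lemma weight_inj (m m' : 'X_{1..n.+1}) :
  (mdeg m < B)%N -> (mdeg m' < B)%N -> weight m = weight m' -> m = m'.
Proof.
have small (m0 : 'X_{1..n.+1}) i : (mdeg m0 < B -> m0 i < B)%N.
  by apply: leq_ltn_trans; rewrite mdegE (bigD1 i) //= leq_addr.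
by move=> mB m'B E; apply/mnmP; apply: radix_inj E => i; exact: small.
Qed.

Lemma shear_var_monic i : shear_var i \is monic /\ size (shear_var i) = (B ^ i).+1.
Proof.
have Bi : (0 < B ^ i)%N by rewrite expn_gt0 B_gt0.
pose h : T := if unlift ord0 i is Some j then ('X_j)%:P else 0.
have lt1 : (size h < size ('X^(B ^ i) : T))%N.
  rewrite size_polyXn ltnS; apply: leq_trans Bi.
  by rewrite /h; case: unlift => [j|]; rewrite ?size_polyC_leq1 ?size_poly0.
rewrite /shear_var -/h.
split; last by rewrite addrC size_polyDl // size_polyXn.
by rewrite monicE addrC lead_coefDl // lead_coefXn.
Qed.

Lemma shear_monomial m :
  shear 'X_[m] \is monic /\ size (shear 'X_[m]) = (weight m).+1.
Proof.
rewrite /shear mmapX /mmap1 /weight.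
elim/big_rec2: _ => [|i w p _ [mp sp]]; first by rewrite monic1 size_poly1.
have [mi si] := shear_var_monic i.
have mXi : shear_var i ^+ m i \is monic by exact: monic_exp.
have sXi : size (shear_var i ^+ m i) = (m i * B ^ i).+1.
  have := size_exp (shear_var i) (m i); rewrite si /= mulnC => <-.
  by rewrite prednK // size_poly_gt0 monic_neq0.
split; first by rewrite monicMl.
by rewrite size_monicM ?monic_neq0 // sXi sp addSn addnS.
Qed.

(** The monomial of largest weight provides alone the leading coefficient in X,
    which is thus a nonzero constant. *)
Lemma lead_coef_shear_unit (s : S) : s != 0 -> (msize s <= B)%N ->
  lead_coef (shear s) \is a GRing.unit.
Proof.
move=> s0 sB.
have [m0 m0s max_m0] : exists2 m0, m0 \in msupp s &
    forall m, m \in msupp s -> (weight m <= weight m0)%N.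
  have exw : exists w, has (fun m => weight m == w) (msupp s).
    exists (weight (mlead s)); apply/hasP; exists (mlead s) => //.
    exact: mlead_supp.
  have ubw w : has (fun m => weight m == w) (msupp s) ->
      (w <= \sum_(m <- msupp s) weight m)%N.
    move=> /hasP[m ms /eqP <-]; rewrite (bigD1_seq m) ?msupp_uniq //=.
    exact: leq_addr.
  have [w /hasP[m0 m0s /eqP <-] wmax] := ex_maxnP exw ubw.
  by exists m0 => // m ms; apply: wmax; apply/hasP; exists m.
rewrite (mpolyE s) (bigD1_seq m0) ?msupp_uniq //= rmorphD /= rmorph_sum.
have [mX sX] := shear_monomial m0.
have sm0 : s@_m0 != 0 by rewrite -mcoeff_msupp.
rewrite -mul_mpolyC rmorphM /= shearC.
have cne0 : (s@_m0)%:MP_[n] != 0 by rewrite mpolyC_eq0.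
rewrite lead_coefDl ?lead_coefM ?lead_coefC ?(monicP mX) ?mulr1.
  by apply: rmorph_unit; rewrite unitfE.
rewrite mul_polyC size_scale // sX ltnS.
rewrite big_seq_cond.
apply: leq_trans (size_sum _ _ _) _; apply/bigmax_leqP_seq => m _ /andP[ms mm0].
rewrite -mul_mpolyC rmorphM /= shearC mul_polyC.
apply: leq_trans (size_scale_leq _ _) _.
rewrite (shear_monomial m).2 ltn_neqAle max_m0 // andbT.
apply: contra mm0 => /eqP E; apply/eqP; apply: weight_inj => //.
  exact: leq_trans (msize_mdeg_lt ms) sB.
exact: leq_trans (msize_mdeg_lt m0s) sB.
Qed.

End Shear.

(** * Degree bounds, and systems for the coefficients *)

Section DegreeBounds.
Variables (k : fieldType) (n : nat).
Implicit Types p q : {mpoly k[n]}.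

Lemma msize_mul_le p q a b :
  (msize p <= a.+1 -> msize q <= b.+1 -> msize (p * q) <= (a + b).+1)%N.
Proof.
move=> pa qb; have [->|p0] := eqVneq p 0; first by rewrite mul0r msize0.
have [->|q0] := eqVneq q 0; first by rewrite mulr0 msize0.
rewrite msizeM //; move: (msize p) (msize q) pa qb => x y; lia.
Qed.

Lemma msize_sum_le (I : Type) (r : seq I) (P : pred I) (F : I -> {mpoly k[n]}) d :
  (forall i, P i -> msize (F i) <= d)%N -> (msize (\sum_(i <- r | P i) F i) <= d)%N.
Proof.
move=> Fd; elim/big_rec: _ => [|i p Pi pd]; first by rewrite msize0.
by apply: leq_trans (msizeD_le _ _) _; rewrite geq_max Fd.
Qed.

Lemma msize_det_le r (Q : 'M[{mpoly k[n]}]_r) d :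
  (forall i j, msize (Q i j) <= d.+1)%N -> (msize (\det Q) <= (r * d).+1)%N.
Proof.
move=> Qd; apply: msize_sum_le => s _.
have -> : (r * d)%N = (0 + r * d)%N by [].
apply: msize_mul_le.
  by rewrite -signr_odd; case: (odd _); rewrite ?expr1 ?expr0 ?msizeN msize1.
rewrite -[X in (X * d)%N]card_ord -sum_nat_const.
elim/big_rec2: _ => [|i p w _ wp]; first by rewrite msize1.
exact: msize_mul_le.
Qed.

Lemma msize_adj_le r (Q : 'M[{mpoly k[n]}]_r) d :
  (forall i j, msize (Q i j) <= d.+1)%N ->
  forall i j, (msize ((\adj Q) i j) <= (r * d).+1)%N.
Proof.
move=> Qd i j; rewrite mxE /cofactor -signr_odd.
have : (r.-1 * d <= r * d)%N by rewrite leq_mul2r leq_pred orbT.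
rewrite -ltnS; apply: leq_trans.
have -> : (r.-1 * d)%N = (0 + r.-1 * d)%N by [].
apply: msize_mul_le.
  by case: (odd _); rewrite ?expr1 ?expr0 ?msizeN msize1.
by apply: msize_det_le => a b; rewrite !mxE.
Qed.

End DegreeBounds.

Section ShearBounds.
Variables (k : fieldType) (n B : nat).
Hypothesis B_gt0 : (0 < B)%N.
Local Notation T := {poly {mpoly k[n]}}.

(** Degree at most [a] in X and degree at most [b] in the other variables. *)
Definition shear_bounded (a b : nat) (p : T) :=
  (size p <= a.+1)%N /\ forall i, (msize p`_i <= b.+1)%N.

Lemma shear_boundedW a b a' b' p : (a <= a')%N -> (b <= b')%N ->
  shear_bounded a b p -> shear_bounded a' b' p.
Proof. by move=> aa bb [pa pb]; split=> [|i]; [lia | have := pb i; lia]. Qed.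

Lemma shear_bounded0 a b : shear_bounded a b 0.
Proof. by split=> [|i]; rewrite ?size_poly0 // coef0 msize0. Qed.

Lemma shear_boundedD a b p q :
  shear_bounded a b p -> shear_bounded a b q -> shear_bounded a b (p + q).
Proof.
move=> [pa pb] [qa qb]; split=> [|i].
  by apply: leq_trans (size_polyD _ _) _; rewrite geq_max pa.
by rewrite coefD; apply: leq_trans (msizeD_le _ _) _; rewrite geq_max pb /=.
Qed.

Lemma shear_boundedM a b a' b' p q : shear_bounded a b p ->
  shear_bounded a' b' q -> shear_bounded (a + a') (b + b') (p * q).
Proof.
move=> [pa pb] [qa qb]; split=> [|i].
  by apply: leq_trans (size_polyMleq _ _) _; lia.
by rewrite coefM; apply: msize_sum_le => j _; apply: msize_mul_le.
Qed.

Lemma shear_boundedC c : shear_bounded 0 0 (c%:MP%:P : T).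
Proof.
split=> [|i]; first by rewrite size_polyC_leq1.
by rewrite coefC; case: eqP => _; rewrite ?msize0 // msizeC; case: eqP.
Qed.

Lemma shear_boundedX (x : nat) a b p :
  shear_bounded a b p -> shear_bounded (x * a) (x * b) (p ^+ x).
Proof.
move=> pab; elim: x => [|x IHx]; first exact: shear_boundedC 1.
by rewrite exprS !mulSn; apply: shear_boundedM.
Qed.

Lemma shear_bounded_var i : shear_bounded (B ^ n) 1 (@shear_var k n B i).
Proof.
have Bi : (B ^ i <= B ^ n)%N by rewrite leq_pexp2l // -ltnS.
split; first by rewrite (shear_var_monic k B_gt0 i).2.
move=> j; rewrite /shear_var coefD; apply: leq_trans (msizeD_le _ _) _.
rewrite geq_max; apply/andP; split.
  case: unlift => [a|]; last by rewrite coef0 msize0.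
  rewrite coefC.
  by case: eqP => _; rewrite ?msize0 // msizeX mdeg1.
by rewrite coefXn -mpolyC_nat msizeC; apply: leq_trans (leq_b1 _) _.
Qed.

Lemma shear_bounded_shear (s : {mpoly k[n.+1]}) d : (msize s <= d.+1)%N ->
  shear_bounded (d * B ^ n) d (shear B s).
Proof.
move=> sd; rewrite (mpolyE s) rmorph_sum big_seq.
elim/big_rec: _ => [|m p ms pb]; first exact: shear_bounded0.
apply: shear_boundedD => //=; rewrite -mul_mpolyC rmorphM /= shearC.
have md : (mdeg m <= d)%N by have := msize_mdeg_lt ms; lia.
apply: (@shear_boundedW (0 + mdeg m * B ^ n) (0 + mdeg m)) => //.
  by rewrite add0n leq_mul2r md orbT.
apply: shear_boundedM; first exact: shear_boundedC.
rewrite /shear mmapX /mmap1 mdegE.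
elim/big_rec2: _ => [|i q w _ wq]; first exact: shear_boundedC 1.
rewrite mulnDl; apply: shear_boundedM => //.
have := shear_boundedX (m i) (shear_bounded_var i).
by rewrite muln1.
Qed.

End ShearBounds.

Section Step.
Variables (A : comNzRingType) (N K : nat) (I J : finType).
Variable (M : I -> J -> {poly A}).
Local Notation T := {poly A}.

(** A vector of polynomials of size at most [N], encoded by all its coefficients. *)
Definition pack (y : J * 'I_N -> A) (j : J) : T :=
  \sum_(s < N) (y (j, s))%:P * 'X^s.

(** The equation [M v = 0] read coefficient by coefficient, as a linear system over
    the coefficient ring. *)
Definition coefficient_system (it : I * 'I_K) (js : J * 'I_N) : A :=
  if (js.2 <= it.2)%N then (M it.1 js.1)`_(it.2 - js.2) else 0.

Lemma coef_row_pack y i t : (\sum_j M i j * pack y j)`_t =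
  \sum_j \sum_(s < N) (if (s <= t)%N then (M i j)`_(t - s) else 0) * y (j, s).
Proof.
rewrite coef_sum; apply: eq_bigr => j _; rewrite mulr_sumr coef_sum.
apply: eq_bigr => s _; rewrite mulrA coefMXn coefMC ltnNge.
by case: (s <= t)%N; rewrite ?mul0r.
Qed.

Lemma size_pack y j : (size (pack y j) <= N)%N.
Proof.
apply: leq_trans (size_sum _ _ _) _; apply/bigmax_leqP => s _.
rewrite mul_polyC; apply: leq_trans (size_scale_leq _ _) _.
by rewrite size_polyXn.
Qed.

Lemma pack_coef (p : J -> T) : (forall j, size (p j) <= N)%N ->
  forall j, pack (fun js => (p js.1)`_js.2) j = p j.
Proof.
move=> pN j; apply/polyP => t; rewrite coef_sum.
have [tN|Nt] := ltnP t N; last first.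
  rewrite (leq_sizeP _ _ (pN j)) // big1 // => s _.
  rewrite coefCM coefXn gtn_eqF ?mulr0 //.
  exact: leq_trans (ltn_ord s) Nt.
rewrite (bigD1 (Ordinal tN)) //= coefCM coefXn eqxx mulr1 big1 ?addr0 // => s.
rewrite -val_eqE /= coefCM coefXn eq_sym => /negPf ->; exact: mulr0.
Qed.

Lemma pack_sum (L : finType) (a : L -> A) (G : L -> J * 'I_N -> A) y :
    (forall js, y js = \sum_l a l * G l js) ->
  forall j, pack y j = \sum_l (a l)%:P * pack (G l) j.
Proof.
move=> yE j; rewrite /pack.
transitivity (\sum_(s < N) \sum_l (a l)%:P * ((G l (j, s))%:P * 'X^s)).
  apply: eq_bigr => s _; rewrite yE (rmorph_sum polyC) mulr_suml.
  by apply: eq_bigr => l _; rewrite /= polyCM mulrA.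
by rewrite exchange_big; apply: eq_bigr => l _; rewrite mulr_sumr.
Qed.

Hypothesis M_size : forall i j, (size (M i j) + N <= K)%N.

Lemma coefficient_systemP y :
  in_kernel coefficient_system y <-> in_kernel M (pack y).
Proof.
have rowE i (t : 'I_K) : \sum_js coefficient_system (i, t) js * y js =
    (\sum_j M i j * pack y j)`_t.
  by rewrite coef_row_pack pair_bigA /=; apply: eq_bigr => -[j s] _.
split=> [ky i|ky [i t]]; last by rewrite rowE ky coef0.
apply/polyP => t; rewrite coef0; have [tK|Kt] := ltnP t K.
  by rewrite -(rowE i (Ordinal tK)) ky.
rewrite coef_sum big1 // => j _; apply/leq_sizeP: Kt.
apply: leq_trans (size_polyMleq _ _) (leq_trans (leq_pred _) _).
by apply: leq_trans (M_size i j); rewrite leq_add2l size_pack.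
Qed.

End Step.

(** * Elimination of a variable *)

Lemma size_quotient_le (A : idomainType) (d p c : {poly A}) (a : nat) :
  d != 0 -> d * p = c -> (size c <= a + size d)%N -> (size p <= a.+1)%N.
Proof.
move=> d0 <-; have [->|p0] := eqVneq p 0; first by rewrite size_poly0.
rewrite size_mul //; have : (0 < size d)%N by rewrite size_poly_gt0.
by move: (size d) (size p) => x y; lia.
Qed.

Lemma size_mul_add (A : nzRingType) (p q : {poly A}) (a b : nat) :
  (size p <= a.+1 -> size q <= b -> size (p * q)%R <= a + b)%N.
Proof.
move=> pa qb; apply: leq_trans (size_polyMleq _ _) _.
by move: (size p) (size q) pa qb => x y; lia.
Qed.

Lemma size_sum_bound (A : nzRingType) (I : finType) (F : I -> {poly A}) a :
  (forall i, size (F i) <= a)%N -> (size (\sum_i F i)%R <= a)%N.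
Proof. by move=> Fa; apply: leq_trans (size_sum _ _ _) _; apply/bigmax_leqP => i _; exact: Fa. Qed.

Section Elimination.
Variables (k : fieldType) (n D : nat) (I J : finType).
Variable (M : I -> J -> {mpoly k[n.+1]}).
Hypotheses (cardI : (#|I| <= D)%N) (M_deg : forall i j, (msize (M i j) <= D.+1)%N).

Let B := (D * D).+1.
Let L := (B ^ n)%N.
Let N := (D * D * L + D * L).+1.
Let K := ((D * L).+1 + N)%N.

(** One step of Hermann's elimination. The minor det Q becomes monic in X up to a
    unit, so solutions can be divided by it with remainder. After subtracting Cramer
    syzygies, of which there is one for each column, the coordinates have size at
    most [N] in X, and their coefficients solve [coefficient_system]. *)
Lemma eliminate_variable (h : nat) :
  (forall M' : I * 'I_K -> J * 'I_N -> {mpoly k[n]},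
     (forall i j, msize (M' i j) <= D.+1)%N -> kernel_generators M' h) ->
  kernel_generators M (#|J| + h).
Proof.
move=> IH; have [r [f [g [rI det0 ext]]]] := nonzero_maximal_minor M.
set Q := \matrix_(a, b) M (f a) (g b) in det0.
have rD : (r <= D)%N := leq_trans rI cardI.
have Q_deg a b : (msize (Q a b) <= D.+1)%N by rewrite mxE.
have rDB : (r * D < B)%N by rewrite ltnS leq_mul2r rD orbT.
have B0 : (0 < B)%N by [].
have lead : lead_coef (shear B (\det Q)) \is a GRing.unit.
  by apply: lead_coef_shear_unit => //; apply: leq_trans (msize_det_le Q_deg) _.
set d := shear B (\det Q) in lead.
have d0 : d != 0.
  by apply: contraTneq lead => ->; rewrite lead_coef0 unitr0.
have d_size : (size d <= (D * D * L).+1)%N.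
  apply: leq_trans (shear_bounded_shear B0 (msize_det_le Q_deg)).1 _.
  by rewrite ltnS leq_mul2r leq_mul2r rD !orbT.
pose MT i j := shear B (M i j).
have MT_bound i j := shear_bounded_shear B0 (M_deg i j).
have MT_size i j : (size (MT i j) + N <= K)%N.
  by rewrite leq_add2r; exact: (MT_bound i j).1.
have [|L0 [G0 [L0h kG0 genG0]]] := IH (coefficient_system MT).
  move=> [i t] [j s]; rewrite /coefficient_system /=; case: ifP => _.
    exact: (MT_bound i j).2.
  by rewrite msize0.
exists (J + L0)%type, (fun l => match l with
  | inl j => cramer_syzygy M f g j
  | inr l => fun j => unshear B (pack (G0 l) j) end); split.
- by rewrite card_sum leq_add2l.
- move=> [j|l]; first exact: in_kernel_cramer_syzygy.
  move=> i; have /(coefficient_systemP MT_size)/(_ i) := kG0 l.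
  move=> /(congr1 (unshear B)); rewrite rmorph0 rmorph_sum => /= {2}<-.
  by apply: eq_bigr => j _; rewrite rmorphM /= shearK.
move=> v Mv.
(* Division with remainder takes place in the univariate ring, where the
   leading coefficient of the minor is a unit. *)
pose u j := unshear B (shear B (v j) %/ d)%R.
pose w j := unshear B (shear B (v j) %% d)%R.
have vE j : v j = \det Q * u j + w j.
  rewrite -[LHS](shearK B) -[\det Q](shearK B) -rmorphM -rmorphD /= mulrC.
  by rewrite -Pdiv.IdomainUnit.divp_eq.
have [] := cramer_reduction ext Mv vE; set y := fun j => v j - _ => My yE.
have w_size j : (size (shear B (w j)) < size d)%N.
  by rewrite unshearK ltn_modp.
(* det Q (y - w) = - adj(Q) M w: the size of the minor, which bounds that of w,
   cancels on both sides. *)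
have y_size j : (size (shear B (y j)) <= N)%N.
  have E : d * (shear B (y j) - shear B (w j)) =
      - shear B (cramer_correction M f g (fun a => \sum_l M (f a) l * w l) j).
    by rewrite -rmorphB -rmorphM yE rmorphN.
  rewrite -[shear B (y j)](subrK (shear B (w j))).
  apply: leq_trans (size_polyD _ _) _; rewrite geq_max; apply/andP; split.
    apply: (size_quotient_le d0 E); rewrite size_polyN rmorph_sum.
    apply: size_sum_bound => b; rewrite rmorphM /= rmorph_nat.
    apply: (@leq_trans (0 + (D * D * L + (D * L + size d)))%N); last by rewrite add0n !addnA.
    apply: size_mul_add.
      by rewrite -polyC_natr size_polyC leq_b1.
    rewrite rmorph_sum; apply: size_sum_bound => a; rewrite rmorphM.
    apply: size_mul_add.
      apply: leq_trans (shear_bounded_shear B0 (msize_adj_le Q_deg b a)).1 _.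
      by rewrite ltnS leq_mul2r leq_mul2r rD !orbT.
    rewrite rmorph_sum; apply: size_sum_bound => l; rewrite rmorphM.
    apply: size_mul_add; first exact: (MT_bound _ _).1.
    exact: ltnW (w_size l).
  by apply: leq_trans (ltnW (w_size j)) (leq_trans d_size _); rewrite ltnS leq_addr.
have packy j := pack_coef y_size j.
have [|a aE] := genG0 (fun js => (shear B (y js.1))`_js.2).
  apply/(coefficient_systemP MT_size) => i.
  under eq_bigr do rewrite packy -rmorphM /=.
  by rewrite -rmorph_sum My rmorph0.
exists (fun l => match l with inl j => u j | inr l => unshear B (a l)%:P end) => j.
rewrite big_sumType /= -[LHS](subrK (\sum_l u l * cramer_syzygy M f g l j)) addrC.
congr (_ + _).
transitivity (unshear B (\sum_l (a l)%:P * pack (G0 l) j)); last first.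
  by rewrite rmorph_sum; apply: eq_bigr => l _; rewrite rmorphM.
rewrite -[LHS]/(y j) -[LHS](shearK B) -packy.
by rewrite (pack_sum aE).
Qed.

End Elimination.

(** A nonzero minor is a unit, so that every solution reduces to zero modulo the
    Cramer syzygies. *)
Lemma kernel_generators_no_variable (k : fieldType) (I J : finType)
    (M : I -> J -> {mpoly k[0]}) : kernel_generators M #|J|.
Proof.
have [r [f [g [_ det0 ext]]]] := nonzero_maximal_minor M.
set Q := \matrix_(a, b) M (f a) (g b) in det0.
have Qu : \det Q \is a GRing.unit.
  rewrite (nvar0_mpolyC (\det Q)); apply: rmorph_unit.
  by rewrite unitfE; apply: contra det0; rewrite {2}(nvar0_mpolyC (\det Q)) mpolyC_eq0.
exists J, (cramer_syzygy M f g); split=> //; first exact: in_kernel_cramer_syzygy.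
move=> v Mv; pose u j := (\det Q)^-1 * v j.
have vE j : v j = \det Q * u j + (fun=> 0) j by rewrite /u mulVKr // addr0.
have [_ yE] := cramer_reduction ext Mv vE.
exists u => j; apply/eqP; rewrite -subr_eq0; apply/eqP.
apply: (mulrI Qu); rewrite mulr0; have := yE j; rewrite subr0 => ->.
apply/eqP; rewrite oppr_eq0; apply/eqP/big1 => b _; rewrite big1 ?mulr0 // => a _.
by rewrite big1 ?mulr0 // => l _; rewrite mulr0.
Qed.

(** One elimination step replaces the bound [T] on sizes and degrees by a power of
    [T] whose exponent depends on the number of variables only. *)
Lemma elimination_size (T n : nat) : (2 <= T)%N ->
  let L := ((T * T).+1 ^ n)%N in
  let N := (T * T * L + T * L).+1 in
  let K := ((T * L).+1 + N)%N in
  [/\ (T * K <= T ^ (3 * n + 6))%N, (T * N <= T ^ (3 * n + 6))%N &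
      (T.+1 <= T ^ (3 * n + 6))%N].
Proof.
move=> T2 L N K.
have L0 : (0 < L)%N by rewrite expn_gt0.
have LT : (L <= T ^ (3 * n))%N.
  rewrite expnM /L; case: (posnP n) => [->//|n0].
  by rewrite leq_exp2r // !expnS expn0; nia.
have big : (T ^ 6 * L <= T ^ (3 * n + 6))%N by rewrite expnD mulnC leq_mul2r LT orbT.
have T4 : (4 <= T * T)%N by nia.
have TTL : (T * L <= T * T * L)%N by nia.
have one : (1 <= T * T * L)%N by nia.
have E6 : (T ^ 6 * L = T * (T * T * L) * (T * T * T))%N by rewrite !expnS expn0; ring.
have T8 : (8 <= T * T * T)%N by nia.
have KT : (T * K <= T ^ 6 * L)%N.
  apply: (@leq_trans (T * (8 * (T * T * L)))%N).
    by rewrite leq_mul2l /K /N; apply/orP; right; lia.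
  by rewrite E6 -[leqRHS]mulnA leq_mul2l [(8 * _)%N]mulnC leq_mul2l T8 !orbT.
split; first exact: leq_trans KT big.
  apply: leq_trans big; apply: leq_trans KT.
  by rewrite leq_mul2l /K leq_addl orbT.
apply: leq_trans big; apply: leq_trans KT; rewrite /K /N; nia.
Qed.

(** Iterating the elimination composes polynomial bounds a fixed number of times.
    The exponent grows very fast with [n], but only its independence of [T]
    matters below. *)
Theorem kernel_generators_polynomial (k : fieldType) (n : nat) :
  exists c : nat, forall T : nat, (2 <= T)%N ->
    forall (I J : finType) (M : I -> J -> {mpoly k[n]}),
      (#|I| <= T)%N -> (#|J| <= T)%N -> (forall i j, msize (M i j) <= T)%N ->
      kernel_generators M (T ^ c).
Proof.
elim: n => [|n [c IHn]].
  exists 1%N => T _ I J M _ JT _; apply: kernel_generatorsW JT _.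
  exact: kernel_generators_no_variable.
exists ((3 * n + 6) * c + 2)%N => T T2 I J M IT JT MT.
have [KT NT T1T] := elimination_size n T2.
have M_deg i j : (msize (M i j) <= T.+1)%N by exact: leqW.
have := @eliminate_variable k n T I J M IT M_deg ((T ^ (3 * n + 6)) ^ c)%N.
move=> /(_ _)/kernel_generatorsW; apply.
  have : (0 < (T ^ (3 * n + 6)) ^ c)%N by rewrite !expn_gt0; lia.
  rewrite [(T ^ (_ * c + 2))%N]expnD expnM -mulnn; set x := ((T ^ _) ^ c)%N => x0.
  apply: leq_trans (leq_add JT (leqnn x)) _.
  have T0 : (0 < T)%N by apply: ltnW.
  have TX : (2 * (T * x) <= x * (T * T))%N.
    by rewrite [leqRHS]mulnC -mulnA leq_mul2r T2 orbT.
  apply: leq_trans TX; rewrite mul2n -addnn leq_add //; first exact: leq_pmulr.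
  exact: leq_pmull.
move=> M' M'T; apply: IHn.
- by apply: leq_trans T1T; lia.
- apply: leq_trans KT; rewrite card_prod card_ord leq_mul2r IT orbT //.
- apply: leq_trans NT; rewrite card_prod card_ord leq_mul2r JT orbT //.
- by move=> i j; apply: leq_trans (M'T i j) T1T.
Qed.

(** * Hilbert's basis theorem *)

Definition is_ideal (A : comNzRingType) (I : set A) : Prop :=
  I 0 /\ forall a x y, I x -> I y -> I (a * x + y).

Section IdealTheory.
Variables (A : comNzRingType) (I : set A).
Hypothesis I_ideal : is_ideal I.

Lemma ideal0 : I 0. Proof. by case: I_ideal. Qed.
Lemma idealMl a x : I x -> I (a * x).
Proof. by move=> Ix; rewrite -[_ * _]addr0; case: I_ideal => I0 /(_ a x 0); apply. Qed.
Lemma idealD x y : I x -> I y -> I (x + y).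
Proof. by move=> Ix Iy; rewrite -[x]mul1r; case: I_ideal => _; apply. Qed.
Lemma idealB x y : I x -> I y -> I (x - y).
Proof. by move=> Ix Iy; rewrite addrC -mulN1r; case: I_ideal => _; apply. Qed.
End IdealTheory.

(** The ideal generated by [s] is encoded as the smallest ideal that contains [s],
    which spares the coefficients of the combinations. *)
Definition noetherian (A : comNzRingType) : Prop :=
  forall I : set A, is_ideal I ->
    exists s : seq A, (forall a, a \in s -> I a) /\
      forall K : set A, is_ideal K -> (forall a, a \in s -> K a) -> I `<=` K.

Lemma noetherian_field (k : fieldType) : noetherian k.
Proof.
move=> I I_ideal; have [[a [Ia a0]]|I0] := pselect (exists a, I a /\ a != 0).
  exists [:: a]; split=> [b|K K_ideal Ka x _]; first by rewrite inE => /eqP ->.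
  by rewrite -[x](divfK a0); apply: idealMl => //; apply: Ka; rewrite inE.
exists [::]; split=> // K K_ideal _ x Ix.
have [->|x0] := eqVneq x 0; first exact: ideal0.
by case: I0; exists x.
Qed.

Lemma noetherian_surj (A B : comNzRingType) (f : {rmorphism A -> B}) :
  (forall y, exists x, f x = y) -> noetherian A -> noetherian B.
Proof.
move=> fsurj noethA I I_ideal.
have preim_ideal (K : set B) : is_ideal K -> is_ideal (f @^-1` K).
  move=> K_ideal; split=> [|a x y Kx Ky]; rewrite /preimage /=.
    by rewrite rmorph0; exact: ideal0.
  by rewrite rmorphD rmorphM; case: K_ideal => _; apply.
have [s [sI genI]] := noethA _ (preim_ideal I I_ideal).
exists (map f s); split=> [_ /mapP[a /sI ? ->]//|K K_ideal sK y Iy].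
have [x fx] := fsurj y; rewrite -fx.
by apply: (genI _ (preim_ideal K K_ideal)) => [a a_s|]; [exact/sK/map_f|rewrite /preimage /= fx].
Qed.

Section HilbertBasis.
Variable A : comNzRingType.
Hypothesis noethA : noetherian A.

Definition top_coefficients (I : set {poly A}) (d : nat) : set A :=
  [set a | exists p, [/\ I p, (size p <= d.+1)%N & p`_d = a]].

Lemma top_coefficients_ideal I d : is_ideal I -> is_ideal (top_coefficients I d).
Proof.
move=> I_ideal; split=> [|a _ _ [p [Ip sp <-]] [q [Iq sq <-]]].
  by exists 0; split; rewrite ?coef0 ?size_poly0 //; exact: ideal0.
exists (a%:P * p + q); split; first by case: I_ideal => _; apply.
  rewrite mul_polyC; apply: leq_trans (size_polyD _ _) _; rewrite geq_max sq andbT.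
  exact: leq_trans (size_scale_leq _ _) _.
by rewrite coefD coefCM.
Qed.

Lemma top_coefficients_le I d e : is_ideal I -> (d <= e)%N ->
  top_coefficients I d `<=` top_coefficients I e.
Proof.
move=> I_ideal de a [p [Ip sp pa]]; exists ('X^(e - d) * p); split.
- exact: idealMl.
- apply: leq_trans (size_polyMleq _ _) _; rewrite size_polyXn; lia.
- by rewrite coefXnM ltnNge leq_subr /= subKn.
Qed.

Lemma size_sub_top (p r : {poly A}) e : (size p <= e.+1)%N -> (size r <= e.+1)%N ->
  p`_e = r`_e -> (size (p - r)%R <= e)%N.
Proof.
move=> sp sr pr; apply/leq_sizeP => i; rewrite leq_eqVlt coefB => /predU1P[<-|ei].
  by rewrite pr subrr.
by rewrite !(leq_sizeP _ e.+1 _) ?subrr.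
Qed.

(** Induction on the degree bound: the coefficients of X^d of the elements of degree
    at most [d] form a finitely generated ideal, and subtracting elements that
    realize them lowers the degree. *)
Lemma bounded_degree_generators I d : is_ideal I ->
  exists s : seq {poly A}, (forall p, p \in s -> I p) /\
    forall K, is_ideal K -> (forall p, p \in s -> K p) ->
      forall p, I p -> (size p <= d)%N -> K p.
Proof.
move=> I_ideal; elim: d => [|d [s [sI genI]]].
  exists [::]; split=> // K K_ideal _ p _; rewrite leqn0 size_poly_eq0 => /eqP ->.
  exact: ideal0.
have [t [tI gent]] := noethA (top_coefficients_ideal d I_ideal).
have /choice[f fP] : forall a, exists p, a \in t ->
    [/\ I p, (size p <= d.+1)%N & p`_d = a].
  move=> a; have [/tI[p Pp]|_] := boolP (a \in t); first by exists p.
  by exists 0.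
exists (s ++ map f t); split=> [p|K K_ideal sK p Ip sp].
  by rewrite mem_cat => /orP[/sI//|/mapP[a /fP[Ifa _ _] ->]].
have IK_ideal : is_ideal (I `&` K).
  split=> [|a x y [Ix Kx] [Iy Ky]]; first by split; exact: ideal0.
  by split; [case: I_ideal|case: K_ideal] => _; apply.
have [||r [[Ir Kr] sr pr]] := gent _ (top_coefficients_ideal d IK_ideal) _ p`_d.
- move=> a a_t; have [Ifa sfa fa] := fP a a_t; exists (f a); split=> //.
  by split=> //; apply: sK; rewrite mem_cat map_f ?orbT.
- by exists p.
rewrite -[p](subrK r); apply: idealD => //; apply: genI => //.
- by move=> q qs; apply: sK; rewrite mem_cat qs.
- exact: idealB.
- by apply: size_sub_top.
Qed.

(** The ideal of all leading coefficients is finitely generated, hence is reached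
    in some degree [D]; beyond [D], leading terms cancel against multiples of
    generators of degree at most [D]. *)
Theorem noetherian_poly : noetherian {poly A}.
Proof.
move=> I I_ideal; pose L := [set a | exists d, top_coefficients I d a].
have L_ideal : is_ideal L.
  split=> [|a x y [d dx] [e ey]].
    by exists 0%N; exact: ideal0 (top_coefficients_ideal 0 I_ideal).
  exists (maxn d e); have [_] := top_coefficients_ideal (maxn d e) I_ideal; apply.
    exact: top_coefficients_le (leq_maxl _ _) _ dx.
  exact: top_coefficients_le (leq_maxr _ _) _ ey.
have [t [tL gent]] := noethA L_ideal.
have [D tD] : exists D, forall a, a \in t -> top_coefficients I D a.
  elim: t tL {gent} => [|a t IHt] tL; first by exists 0%N.
  have [|D tD] := IHt; first by move=> b bt; apply: tL; rewrite inE bt orbT.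
  have [d ad] := tL a (mem_head _ _); exists (maxn d D) => b.
  rewrite inE => /predU1P[->|/tD bD].
    exact: top_coefficients_le (leq_maxl _ _) _ ad.
  exact: top_coefficients_le (leq_maxr _ _) _ bD.
have [s [sI gens]] := bounded_degree_generators D.+1 I_ideal.
exists s; split=> // K K_ideal sK p Ip.
have IK_ideal : is_ideal (I `&` K).
  split=> [|a x y [Ix Kx] [Iy Ky]]; first by split; exact: ideal0.
  by split; [case: I_ideal|case: K_ideal] => _; apply.
have tK e : (D <= e)%N -> L `<=` top_coefficients (I `&` K) e.
  move=> De; apply: gent; first exact: top_coefficients_ideal.
  move=> a /tD[q [Iq sq qa]]; apply: top_coefficients_le De _ _ => //.
  by exists q; split=> //; split=> //; exact: (gens K).
have [m sp] := ubnP (size p); elim: m p Ip sp => // m IHm p Ip.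
rewrite ltnS leq_eqVlt => /predU1P[sp|]; last exact: IHm.
have [mD|Dm] := leqP m D.+1; first by apply: (gens K) => //; rewrite sp.
have m0 : m = m.-1.+1 by rewrite prednK //; apply: leq_ltn_trans Dm.
have [||r [[Ir Kr] sr pr]] := tK m.-1 _ p`_m.-1; first by lia.
  by exists m.-1, p; split=> //; rewrite -m0 sp.
rewrite -[p](subrK r); apply: idealD => //; apply: IHm; first exact: idealB.
by rewrite [X in (_ < X)%N]m0 ltnS; apply: size_sub_top; rewrite -?m0 ?sp // m0.
Qed.

End HilbertBasis.

(** The substitution [shear] with [B = 1] is used only as an isomorphism between
    polynomials in n + 1 variables and univariate polynomials. *)
Theorem noetherian_mpoly (k : fieldType) (n : nat) : noetherian {mpoly k[n]}.
Proof.
elim: n => [|n IHn].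
  apply: (@noetherian_surj k {mpoly k[0]} (@mpolyC 0 k)); last exact: noetherian_field.
  by move=> p; exists p@_0%MM; rewrite [RHS]nvar0_mpolyC.
apply: (@noetherian_surj {poly {mpoly k[n]}} {mpoly k[n.+1]} (@unshear k n 1)).
  by move=> s; exists (shear 1 s); exact: shearK.
exact: noetherian_poly.
Qed.

(** * Linear extension of maps given by their graphs *)

Section SubmoduleType.
Variables (R : comNzRingType) (V : lmodType R) (U : set V).
Hypothesis U_sub : is_submodule U.

(** The proof is an argument so that the submodule structure on the subtype below
    can be found from the type. *)
Definition in_submodule of is_submodule U := fun x : V => `[< U x >].

Lemma in_submodule_closed : submod_closed (in_submodule U_sub).
Proof.
case: U_sub => U0 UL; split=> [|a x y /asboolP Ux /asboolP Uy]; apply/asboolP => //.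
exact: UL.
Qed.

HB.instance Definition _ := GRing.isSubmodClosed.Build R V (in_submodule U_sub)
  (GRing.submod_closed_semi in_submodule_closed).

Record submodule_type :=
  SubmoduleType { submodule_val :> V; _ : submodule_val \in in_submodule U_sub }.

HB.instance Definition _ := [isSub for submodule_val].
HB.instance Definition _ := [Choice of submodule_type by <:].
HB.instance Definition _ := [SubChoice_isSubLmodule of submodule_type by <:].

End SubmoduleType.

Section InjectiveExtension.
Variables (R : comNzRingType) (N E : lmodType R).
Hypothesis E_inj : injective_module E.

(** A partial linear map is given by its graph; the graph itself, with its two
    projections, is the source of the map to extend. *)
Lemma injective_graph_extension (U : set (N * E)) : is_submodule U ->
    (forall y, U (0, y) -> y = 0) ->
  exists g : {linear N -> E}, forall x y, U (x, y) -> g x = y.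
Proof.
move=> U_sub U_fun; pose M := submodule_type U_sub.
have fst_lin : linear (fun m : M => (val m).1) by move=> a x y; rewrite linearP.
have snd_lin : linear (fun m : M => (val m).2) by move=> a x y; rewrite linearP.
pose i := HB.pack_for {linear M -> N} (fun m : M => (val m).1)
  (GRing.isLinear.Build R M N *:%R _ fst_lin).
pose f := HB.pack_for {linear M -> E} (fun m : M => (val m).2)
  (GRing.isLinear.Build R M E *:%R _ snd_lin).
have i_inj : injective i.
  move=> [[x y] Uxy] [[x' y'] Uxy'] /= xx'; apply: val_inj => /=; subst x'.
  move: Uxy Uxy'; rewrite !unfold_in => /asboolP Uxy /asboolP Uxy'.
  congr (_, _); apply/eqP; rewrite -subr_eq0; apply/eqP/U_fun.
  have := U_sub.2 (-1) _ _ Uxy' Uxy; congr (U (_, _)) => /=.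
    by rewrite scaleN1r addNr.
  by rewrite scaleN1r addrC.
have [g gP] := E_inj f i_inj; exists g => x y Uxy.
have Mxy : (x, y) \in in_submodule U_sub by apply/asboolP.
exact: (gP (SubmoduleType Mxy)).
Qed.

End InjectiveExtension.

Section FunctionalExtension.
Variables (k : fieldType) (V : lmodType k).

Definition functional_graph (G : set (V * k^o)) : Prop :=
  is_submodule G /\ forall c, G (0, c) -> c = 0.

(** A functional that is not defined at [x] extends by the value 0 at [x]. *)
Lemma functional_graph_extend G x : functional_graph G ->
    ~ (exists c, G (x, c)) ->
  functional_graph [set vc | exists a, G (vc.1 - a *: x, vc.2)].
Proof.
move=> [[G0 GL] G_fun] Gx; split; first split.
- by exists 0; rewrite /= scale0r subr0.
- move=> a [v c] [w d] /= [b Gv] [b' Gw]; exists (a * b + b').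
  have := GL a _ _ Gv Gw; congr (G (_, _)).
  by rewrite /= scalerDl -scalerA scalerBr addrACA opprD.
move=> c [a /=]; rewrite sub0r.
have [->|a0] := eqVneq a 0; first by rewrite scale0r oppr0 => /G_fun.
move=> Gax; case: Gx; exists (- a^-1 * c).
have := GL (- a^-1) _ _ Gax G0; congr (G (_, _)); rewrite /= addr0 //.
by rewrite scalerN scaleNr opprK scalerA mulVf // scale1r.
Qed.

(** Vector spaces are injective: a maximal functional graph containing [U], obtained
    by Zorn's lemma, is everywhere defined. *)
Lemma functional_extension (U : set (V * k^o)) : functional_graph U ->
  exists g : {linear V -> k^o}, forall x c, U (x, c) -> g x = c.
Proof.
move=> U_graph.
(* Adding U to every set makes the union of the empty chain admissible. *)
pose P := [set G : set (V * k^o) | functional_graph (U `|` G)].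
have [F FP totF|G [PG maxG]] := @Zorn_bigcup _ P.
  have [[X0 FX0]|F0] := pselect (exists X, F X); last first.
    rewrite /P /= (_ : \bigcup_(X in F) X = set0) ?setU0 //.
    by apply/seteqP; split=> // x [X FX _]; case: F0; exists X.
  have both x y : (U `|` \bigcup_(X in F) X) x -> (U `|` \bigcup_(X in F) X) y ->
      exists2 X, F X & (U `|` X) x /\ (U `|` X) y.
    move=> [Ux|[X FX Xx]] [Uy|[Y FY Yy]].
    - by exists X0 => //; split; left.
    - by exists Y => //; split; [left|right].
    - by exists X => //; split; [right|left].
    have [XY|YX] := totF _ _ FX FY.
      by exists Y => //; split; right=> //; exact: XY.
    by exists X => //; split; right=> //; exact: YX.
  have incl X : F X -> (U `|` X) `<=` (U `|` \bigcup_(X in F) X).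
    by move=> FX x [Ux|Xx]; [left|right; exists X].
  split; first split.
  - by left; case: U_graph => -[].
  - move=> a x y /both/[apply] -[X FX [Xx Xy]]; apply: (incl X FX).
    by case: (FP X FX) => -[_ XL] _; exact: XL.
  - move=> c Fc; have [X FX [Xc _]] := both _ _ Fc Fc.
    by case: (FP X FX) => _; apply.
have [G0 GL] := PG.1; set H := U `|` G in PG G0 GL.
have H_total x : exists c, H (x, c).
  apply: contrapT => Hx; have Hx_graph := functional_graph_extend PG Hx.
  set H' := [set vc | _] in Hx_graph.
  have HH' : H `<=` H' by move=> [v c] Hvc; exists 0; rewrite scale0r subr0.
  apply: (maxG H'); last first.
    rewrite /P /= (_ : U `|` H' = H') //; apply/setUidPr => v Uv.
    by apply: HH'; left.
  split; last first.
    move=> H'G; apply: Hx; exists 0; right; apply: H'G.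
    by exists 1; rewrite /= scale1r subrr.
  by move=> v Gv; apply: HH'; right.
have [g gP] := choice H_total.
have uniq x c : H (x, c) -> g x = c.
  move=> Hxc; apply/eqP; rewrite -subr_eq0; apply/eqP/PG.2.
  have := GL (-1) _ _ Hxc (gP x); congr (H (_, _)); rewrite /= scaleN1r addrC ?subrr //.
have g_lin : linear (g : V -> k^o).
  by move=> a x y; apply: uniq; exact: (GL a (x, g x) (y, g y)).
exists (HB.pack_for {linear V -> k^o} g (GRing.isLinear.Build k V k^o *:%R g g_lin)).
by move=> x c Uxc; apply: uniq; left.
Qed.

End FunctionalExtension.

(** * Inverse polynomials *)

Lemma mnm_neq0_var (n : nat) (m : 'X_{1..n}) : m != 0%MM -> exists i, m i != 0%N.
Proof.
move=> m0; apply/existsP; apply: contraNT m0; rewrite negb_exists => /forallP m_i.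
by apply/eqP/mnmP => i; rewrite mnm0E; apply/eqP; have := m_i i; rewrite negbK.
Qed.

Lemma mpolyX_var (R : nzRingType) (n : nat) (m : 'X_{1..n}) i : m i != 0%N ->
  'X_[m] = 'X_[m - U_(i)] * 'X_i :> {mpoly R[n]}.
Proof. by move=> mi; rewrite -mpolyXD submK // lep1mP. Qed.

Section Functionals.
Variables (k : fieldType) (n : nat).
Local Notation S := {mpoly k[n]}.
Local Notation dual := ('X_{1..n} -> k).
Implicit Types (d : dual) (s t : S).

(** An inverse polynomial [d] is identified with the linear functional on S that
    takes the value [d m] at the monomial [m]. *)
Definition pairing d s : k := \sum_(m <- msupp s) s@_m * d m.

Lemma pairing_bounded d s i : (msize s <= i)%N ->
  pairing d s = \sum_(m : 'X_{1..n < i}) s@_m * d m.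
Proof.
move=> le_si; set I : subFinType _ := 'X_{1..n < i}.
rewrite /pairing (big_mksub I) ?msupp_uniq //=; first last.
  by move=> x /msize_mdeg_lt /leq_trans; apply.
by rewrite big_rmcond //= => j /memN_msupp_eq0 ->; rewrite mul0r.
Qed.

Lemma pairing_is_linear d : linear (pairing d : S -> k^o).
Proof.
move=> a s t; pose i := maxn (msize (a *: s + t)) (maxn (msize s) (msize t)).
rewrite !(@pairing_bounded d _ i) /i ?leq_maxl // ?leq_max ?leqnn ?orbT //.
rewrite scaler_sumr -big_split; apply: eq_bigr => m _ /=.
by rewrite mcoeffD mcoeffZ mulrDl -mulrA.
Qed.

HB.instance Definition _ d :=
  GRing.isLinear.Build k S k^o *:%R (pairing d) (pairing_is_linear d).

Lemma pairing0 d : pairing d 0 = 0. Proof. exact: linear0. Qed.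
Lemma pairingD d s t : pairing d (s + t) = pairing d s + pairing d t.
Proof. exact: linearD. Qed.
Lemma pairingZ d a s : pairing d (a *: s) = a * pairing d s.
Proof. exact: linearZ. Qed.

Lemma pairing_sum d (I : Type) (r : seq I) (P : pred I) (F : I -> S) :
  pairing d (\sum_(i <- r | P i) F i) = \sum_(i <- r | P i) pairing d (F i).
Proof. exact: linear_sum. Qed.

Lemma pairingX d m : pairing d 'X_[m] = d m.
Proof. by rewrite /pairing msuppX big_seq1 mcoeffX eqxx mul1r. Qed.

Lemma pairing_ext d s : (forall m, m \in msupp s -> d m = 0) -> pairing d s = 0.
Proof. by move=> ds; rewrite /pairing big_seq big1 // => m /ds ->; rewrite mulr0. Qed.

(** Contraction: [act s d] is the functional [t |-> pairing d (s * t)]. *)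
Definition act s d : dual := fun m => pairing d (s * 'X_[m]).

Lemma linear_mpoly_ext (V : lmodType k) (f g : {linear S -> V}) :
  (forall m, f 'X_[m] = g 'X_[m]) -> f =1 g.
Proof.
move=> fg s; rewrite (mpolyE s) !linear_sum; apply: eq_bigr => m _.
by rewrite !linearZ fg.
Qed.

Lemma pairing_act s d t : pairing (act s d) t = pairing d (s * t).
Proof.
rewrite [in RHS](mpolyE t) mulr_sumr linear_sum; apply: eq_bigr => m _ /=.
by rewrite -scalerAr linearZ.
Qed.

Lemma act0 s : act s 0 = 0.
Proof. by apply/funext => m; apply: pairing_ext. Qed.

Lemma act0l d : act 0 d = 0.
Proof. by apply/funext => m; rewrite /act mul0r pairing0. Qed.

Lemma actM s t d : act (s * t) d = act s (act t d).
Proof. by apply/funext => m; rewrite [RHS]pairing_act mulrCA mulrA. Qed.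

Lemma act1 d : act 1 d = d.
Proof. by apply/funext => m; rewrite /act mul1r pairingX. Qed.

Lemma actDl s t d : act (s + t) d = act s d + act t d.
Proof. by apply/funext => m; rewrite /act mulrDl linearD. Qed.

Lemma actZ a s d m : act (a *: s) d m = a * act s d m.
Proof. by rewrite /act -scalerAl linearZ. Qed.

Lemma act_sum (I : Type) (r : seq I) (P : pred I) (F : I -> S) d :
  act (\sum_(i <- r | P i) F i) d = \sum_(i <- r | P i) act (F i) d.
Proof.
elim/big_rec2: _ => [|i d' s _ <-]; last by rewrite actDl.
by apply/funext => m; rewrite /act mul0r linear0.
Qed.

Lemma pairingDl d d' s : pairing (d + d') s = pairing d s + pairing d' s.
Proof.
rewrite /pairing -big_split; apply: eq_bigr => m _; exact: mulrDr.
Qed.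

Lemma actDr s d d' : act s (d + d') = act s d + act s d'.
Proof. by apply/funext => m; rewrite [LHS]pairingDl. Qed.

Lemma act_sumr s (I : Type) (r : seq I) (P : pred I) (F : I -> dual) :
  act s (\sum_(i <- r | P i) F i) = \sum_(i <- r | P i) act s (F i).
Proof. by elim/big_rec2: _ => [|i d d' _ <-]; rewrite ?act0 ?actDr. Qed.

Lemma act_monomial d a m m' : act (a *: 'X_[m]) d m' = a * d (m + m')%MM.
Proof. by rewrite actZ /act -mpolyXD pairingX. Qed.

Lemma annihilator_ideal d s t a : act s d = 0 -> act t d = 0 -> act (a * s + t) d = 0.
Proof. by move=> sd td; rewrite actDl actM sd td act0 addr0. Qed.

(** Since there are finitely many monomials of each degree, [d] satisfies this for
    some [t] exactly when its support is finite. *)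
Definition vanishes_from (t : nat) d := forall m : 'X_{1..n}, (t <= mdeg m)%N -> d m = 0.

Lemma pairing_vanishes (t : nat) d s : vanishes_from t d ->
  (forall m, m \in msupp s -> (t <= mdeg m)%N) -> pairing d s = 0.
Proof. by move=> dt st; apply: pairing_ext => m /st/dt. Qed.

Lemma vanishes_act (t : nat) s d : vanishes_from t d -> vanishes_from t (act s d).
Proof.
move=> dt m tm; apply: pairing_vanishes dt _ => m'.
rewrite (perm_mem (msuppMX _ _)) => /mapP[m0 _ ->].
by rewrite mdegD (leq_trans tm) // leq_addr.
Qed.

Lemma vanishes_actX (t : nat) i d : vanishes_from t.+1 d -> vanishes_from t (act 'X_i d).
Proof.
by move=> dt m tm; rewrite /act -mpolyXD pairingX dt // mdegD mdeg1.
Qed.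

Lemma vanishes_le (t t' : nat) d : (t <= t')%N -> vanishes_from t d -> vanishes_from t' d.
Proof. by move=> tt' dt m t'm; apply: dt; apply: leq_trans t'm. Qed.

Definition truncate (t : nat) s : S := \sum_(i < t) pihomog mdeg i s.

Lemma truncate_is_linear (t : nat) : linear (truncate t).
Proof.
by move=> a p q; rewrite /truncate scaler_sumr -big_split; apply: eq_bigr => i _; rewrite linearP.
Qed.

HB.instance Definition _ (t : nat) :=
  GRing.isLinear.Build k S S *:%R (truncate t) (truncate_is_linear t).

Lemma truncate_homog (t : nat) p (e : nat) : p \is e.-homog ->
  truncate t p = if (e < t)%N then p else 0.
Proof.
move=> pe; rewrite /truncate; case: ltnP => [et|te].
  rewrite (bigD1 (Ordinal et)) //= pihomog_dE // big1 ?addr0 // => i.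
  by rewrite -val_eqE /= eq_sym => ie; rewrite (pihomog_ne0 ie pe).
rewrite big1 // => i _; rewrite (pihomog_ne0 _ pe) //.
by rewrite gtn_eqF // (leq_trans (ltn_ord i)).
Qed.

Lemma truncateX (t : nat) m : truncate t 'X_[m] = if (mdeg m < t)%N then 'X_[m] else 0.
Proof. by apply: truncate_homog; rewrite dhomogX. Qed.

(** The truncated subtraction is harmless: if [t <= e] then both sides vanish. *)
Lemma truncateM (t : nat) s p (e : nat) : p \is e.-homog ->
  truncate t (s * p) = truncate (t - e) s * p.
Proof.
move=> pe; elim/mpolyind: s => [|c m s _ _ IHs].
  by rewrite mul0r !linear0 mul0r.
rewrite mulrDl (linearD (truncate t)) (linearD (truncate (t - e))) /= IHs mulrDl.
congr (_ + _).
rewrite -scalerAl !linearZ /= -[RHS]scalerAl.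
congr (_ *: _).
rewrite (@truncate_homog _ _ (mdeg m + e)) ?truncateX; last first.
  by apply: dhomogM => //; rewrite dhomogX.
by rewrite ltn_subRL addnC; case: ifP; rewrite ?mul0r.
Qed.

Lemma pairing_truncate (t : nat) d s : vanishes_from t d -> pairing d (truncate t s) = pairing d s.
Proof.
move=> dt; elim/mpolyind: s => [|c m s _ _ IHs]; first by rewrite linear0.
rewrite !linearP /= IHs; congr (_ * _ + _).
by rewrite truncateX pairingX; case: ltnP => [_|/dt ->]; rewrite ?pairingX ?linear0.
Qed.

End Functionals.

(** * The injective hull as a space of inverse polynomials *)

(** R is the localization of S / J at the ideal of the variables, expressed without
    the quotient: an element of S is outside the maximal ideal when its constant
    term is nonzero. *)
Record localizes_at_origin (k : fieldType) (n : nat) (J : set {mpoly k[n]})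
    (R : comUnitRingType) (sigma : {rmorphism {mpoly k[n]} -> R}) : Prop :=
  LocalizesAtOrigin {
    local_unit : forall s, s@_0%MM != 0 -> sigma s \is a GRing.unit;
    local_frac : forall r, exists s a, s@_0%MM != 0 /\ sigma s * r = sigma a;
    local_ker : forall a, sigma a = 0 -> exists s, s@_0%MM != 0 /\ J (s * a);
    local_ideal : forall a, J a -> sigma a = 0
  }.

(** All that is needed of an essential extension of the residue field: the image [u]
    of 1 is killed by the variables, and every nonzero submodule contains it. *)
Record socle_generator (k : fieldType) (n : nat)
    (R : comUnitRingType) (sigma : {rmorphism {mpoly k[n]} -> R})
    (E : lmodType R) (u : E) : Prop := SocleGenerator {
  socle_neq0 : u != 0;
  socle_var : forall i, sigma 'X_i *: u = 0;
  socle_essential : forall x : E, x != 0 -> exists s, sigma s *: x = u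
}.

Section Hull.
Variables (k : fieldType) (n : nat) (J : set {mpoly k[n]}).
Variables (R : comUnitRingType) (sigma : {rmorphism {mpoly k[n]} -> R}).
Hypothesis loc : localizes_at_origin J sigma.
Local Notation S := {mpoly k[n]}.
Local Notation dual := ('X_{1..n} -> k).

Lemma mcoeff0M (s t : S) : (s * t)@_0%MM = s@_0%MM * t@_0%MM.
Proof. exact: (rmorphM (mcoeff 0%MM)). Qed.

Lemma local_cancel (V : lmodType R) s (x y : V) : s@_0%MM != 0 ->
  sigma s *: x = sigma s *: y -> x = y.
Proof.
by move=> /(local_unit loc) su xy; rewrite -[x]scale1r -(mulVr su) -scalerA xy scalerA mulVr ?scale1r.
Qed.

Section GraphExtension.
Variables (E N : lmodType R).
Hypothesis E_inj : injective_module E.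

(** A graph that is only stable under S becomes stable under R once it is saturated
    by the elements of S that become invertible. *)
Lemma polynomial_graph_extension (U : set (N * E)) :
    U 0 -> (forall x y, U x -> U y -> U (x + y)) ->
    (forall s x, U x -> U (sigma s *: x)) ->
    (forall y, U (0, y) -> y = 0) ->
  exists g : {linear N -> E}, forall x y, U (x, y) -> g x = y.
Proof.
move=> U0 UD UZ U_fun.
pose U' := [set x | exists s, s@_0%MM != 0 /\ U (sigma s *: x)].
have [| |g gP] := @injective_graph_extension R N E E_inj U'.
- split; first by exists 1; rewrite mcoeff1 eqxx oner_neq0 scaler0.
  move=> r x y [s [s0 Ux]] [t [t0 Uy]]; have [c [a [c0 ca]]] := local_frac loc r.
  exists (c * s * t); split; first by rewrite !mcoeff0M !mulf_neq0.
  rewrite scalerDr; apply: UD; last by rewrite rmorphM -scalerA; exact: UZ.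
  rewrite scalerA.
  suff -> : sigma (c * s * t) * r = sigma (a * t) * sigma s.
    by rewrite -scalerA; exact: UZ.
  rewrite !rmorphM /= -ca; ring.
- move=> y [s [s0]]; rewrite [sigma s *: _](_ : _ = (0, sigma s *: y)); last first.
    by congr (_, _); exact: scaler0.
  by move=> /U_fun sy; apply: (local_cancel s0); rewrite sy scaler0.
exists g => x y Uxy; apply: gP; exists 1; split.
  by rewrite mcoeff1 eqxx oner_neq0.
by rewrite rmorph1 scale1r.
Qed.

End GraphExtension.

Variables (E : lmodType R) (u : E).
Hypothesis soc : socle_generator sigma u.

(** The ideals ann(X_i^t x) increase with t, hence stabilize at some T. If X_i^T x
    were nonzero then some multiple s X_i^T x would be the socle element [u], which
    X_i kills; so s would lie in ann(X_i^(T+1) x) = ann(X_i^T x), and u = 0. *)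
Lemma variable_nilpotent i (x : E) : exists t, sigma ('X_i ^+ t) *: x = 0.
Proof.
pose I := [set s : S | exists t, sigma ('X_i ^+ t * s) *: x = 0].
have I_up s t t' : (t <= t')%N -> sigma ('X_i ^+ t * s) *: x = 0 ->
    sigma ('X_i ^+ t' * s) *: x = 0.
  move=> tt' sx; rewrite -(subnK tt') exprD -mulrA rmorphM -scalerA sx scaler0 //.
have I_ideal : is_ideal I.
  split=> [|a s s' [t sx] [t' s'x]]; first by exists 0%N; rewrite mulr0 rmorph0 scale0r.
  exists (maxn t t'); rewrite mulrDr mulrCA rmorphD scalerDl rmorphM -scalerA.
  by rewrite (I_up _ _ _ (leq_maxl t t') sx) (I_up _ _ _ (leq_maxr t t') s'x) scaler0 addr0.
have [g [gI Igen]] := noetherian_mpoly I_ideal.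
have [T gT] : exists T, forall s, s \in g -> sigma ('X_i ^+ T * s) *: x = 0.
  elim: g gI {Igen} => [|s g IHg] gI; first by exists 0%N.
  have [|T gT] := IHg; first by move=> a ag; apply: gI; rewrite inE ag orbT.
  have [t st] := gI s (mem_head _ _); exists (maxn t T) => a.
  rewrite inE => /predU1P[->|/gT aT]; first exact: I_up (leq_maxl _ _) st.
  exact: I_up (leq_maxr _ _) aT.
have IT s : I s -> sigma ('X_i ^+ T * s) *: x = 0.
  apply: (Igen [set s | sigma ('X_i ^+ T * s) *: x = 0]) => //.
  split=> [|a s1 s2 /= s1x s2x]; first by rewrite /= mulr0 rmorph0 scale0r.
  by rewrite mulrDr mulrCA rmorphD scalerDl rmorphM -scalerA s1x s2x scaler0 addr0.
exists T; apply: contrapT => /eqP/(socle_essential soc)[s sx].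
have /eqP := socle_neq0 soc; apply; rewrite -sx scalerA -rmorphM mulrC.
apply: IT; exists T.+1; rewrite exprS -mulrA rmorphM -scalerA mulrC rmorphM.
by rewrite -(scalerA (sigma s)) sx (socle_var soc).
Qed.

(** A monomial of large degree is divisible by a large power of some variable. *)
Lemma torsion (x : E) : exists t, forall m, (t <= mdeg m)%N -> sigma 'X_[m] *: x = 0.
Proof.
have /choice[t tP] : forall i, exists t, sigma ('X_i ^+ t) *: x = 0.
  by move=> i; exact: variable_nilpotent.
(* The successor matters when there is no variable. *)
exists (\sum_i t i).+1 => m; rewrite mdegE => tm.
have [i ti] : exists i, (t i <= m i)%N.
  apply/existsP; apply: contraLR tm; rewrite negb_exists -leqNgt => /forallP mt.
  by apply: leq_sum => i _; rewrite ltnW // ltnNge.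
have -> : 'X_[m] = 'X_[m - U_(i) *+ t i] * 'X_i ^+ t i :> S.
  rewrite mpolyXn -mpolyXD submK //; apply/mnm_lepP => j.
  rewrite mulmnE mnm1E; case: eqP => [<-|_]; by rewrite ?mul1n ?mul0n.
by rewrite rmorphM -scalerA tP scaler0.
Qed.

Lemma socle_functional_ex : exists lam : E -> k,
  [/\ forall x y, lam (x + y) = lam x + lam y,
      forall c x, lam (sigma c%:MP *: x) = c * lam x & lam u = 1].
Proof.
pose f : {rmorphism k -> R} := sigma \o @mpolyC n k.
pose V := restrict_scalars f E.
pose U := [set xc : V * k^o | xc.1 = sigma (xc.2)%:MP *: u].
have U_graph : functional_graph U.
  split; first split; first by rewrite /U /= mpolyC0 rmorph0 scale0r.
    move=> a [x c] [y d]; rewrite /U /= => -> ->.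
    rewrite -[a *: (_ : V)]/(sigma a%:MP *: (sigma c%:MP *: u)).
    by rewrite mpolyCD mpolyCM rmorphD rmorphM scalerDl scalerA.
  move=> c; rewrite /U /= => cu; apply/eqP; apply: contraT => c0.
  have /eqP := socle_neq0 soc; case; apply: (@local_cancel E c%:MP).
    by rewrite mcoeffC eqxx mulr1.
  by rewrite -cu scaler0.
have [g gP] := functional_extension U_graph.
exists g; split=> [x y|c x|]; first exact: (linearD g).
  exact: (linearZ_LR g c (x : V)).
by apply: gP; rewrite /U /= mpolyC1 rmorph1 scale1r.
Qed.

Variable lam : E -> k.
Hypothesis lamD : forall x y, lam (x + y) = lam x + lam y.
Hypothesis lamZ : forall c x, lam (sigma c%:MP *: x) = c * lam x.
Hypothesis lam_u : lam u = 1.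

(** The embedding of E into inverse polynomials induced by a functional [lam] that
    does not vanish on the socle. *)
Definition to_dual (x : E) : dual := fun m => lam (sigma 'X_[m] *: x).

Lemma lam0 : lam 0 = 0.
Proof. by apply: (addrI (lam 0)); rewrite -lamD !addr0. Qed.

Lemma pairing_to_dual x s : pairing (to_dual x) s = lam (sigma s *: x).
Proof.
elim/mpolyind: s => [|c m s _ _ IHs]; first by rewrite pairing0 rmorph0 scale0r lam0.
rewrite pairingD IHs rmorphD scalerDl lamD pairingZ; congr (_ + _).
by rewrite -mul_mpolyC rmorphM -scalerA lamZ /= pairingX.
Qed.

Lemma to_dualZ s x : to_dual (sigma s *: x) = act s (to_dual x).
Proof.
by apply/funext => m; rewrite /act pairing_to_dual /to_dual scalerA -rmorphM mulrC.
Qed.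

Lemma to_dualD x y : to_dual (x + y) = to_dual x + to_dual y.
Proof. by apply/funext => m; rewrite /to_dual scalerDr lamD. Qed.

Lemma to_dual0 : to_dual 0 = 0.
Proof. by apply/funext => m; rewrite /to_dual scaler0 lam0. Qed.

Lemma to_dual_sum (I : Type) (r : seq I) (P : pred I) (F : I -> E) :
  to_dual (\sum_(i <- r | P i) F i) = \sum_(i <- r | P i) to_dual (F i).
Proof. by elim/big_rec2: _ => [|i d d' _ <-]; rewrite ?to_dual0 ?to_dualD. Qed.

(** A nonzero [x] has a multiple equal to [u], on which the functional is 1. *)
Lemma to_dual_eq0 x : to_dual x = 0 -> x = 0.
Proof.
move=> x0; apply: contrapT => /eqP/(socle_essential soc)[s sx].
have : lam u = 0; last by rewrite lam_u => /eqP; rewrite oner_eq0.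
by rewrite -sx -pairing_to_dual x0; apply: pairing_ext.
Qed.

Lemma to_dual_inj : injective to_dual.
Proof.
move=> x y xy; apply/eqP; rewrite -subr_eq0; apply/eqP/to_dual_eq0.
rewrite to_dualD xy -scaleN1r -(rmorph1 sigma) -rmorphN to_dualZ.
by rewrite -[X in X + _]act1 -actDl subrr; apply/funext => m; rewrite /act mul0r pairing0.
Qed.

Lemma to_dual_ideal x a : J a -> act a (to_dual x) = 0.
Proof. by move=> Ja; rewrite -to_dualZ (local_ideal loc Ja) scale0r to_dual0. Qed.

Lemma to_dual_vanishes x : exists t, vanishes_from t (to_dual x).
Proof. by have [t tx] := torsion x; exists t => m /tx mx; rewrite /to_dual mx lam0. Qed.

Hypothesis E_inj : injective_module E.

Lemma to_dual_u m : to_dual u m = (m == 0%MM)%:R.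
Proof.
rewrite /to_dual; have [->|m0] := eqVneq; first by rewrite mpolyX0 rmorph1 scale1r.
have [i mi] := mnm_neq0_var m0.
by rewrite (mpolyX_var k mi) rmorphM -scalerA (socle_var soc) scaler0 lam0.
Qed.

(** Induction on the degree bound. The contractions X_i d come from elements y_i,
    and the relations between the X_i in R hold between the y_i, because they hold
    after the embedding. By injectivity of E the map X_i |-> y_i extends from the
    maximal ideal to R; the image of 1 corresponds to [d] up to a function supported
    on the monomial 1, that is, up to a multiple of [u]. *)
Lemma to_dual_surj t d : vanishes_from t d -> (forall a, J a -> act a d = 0) ->
  exists x, to_dual x = d.
Proof.
elim: t d => [|t IHt] d dt dJ.
  by exists 0; rewrite to_dual0; apply/funext => m; rewrite dt.
have /choice[y yP] : forall i, exists y, to_dual y = act 'X_i d.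
  move=> i; apply: IHt; first exact: vanishes_actX.
  by move=> a Ja; rewrite -actM mulrC actM dJ // act0.
(* The graph of X_i |-> y_i on the ideal of the variables. *)
pose U := [set ry : R^o * E | exists a : 'I_n -> S,
  ry = (sigma (\sum_i a i * 'X_i), \sum_i sigma (a i) *: y i)].
have [||||g gP] := @polynomial_graph_extension E R^o E_inj U.
- exists (fun=> 0); congr (_, _); first by rewrite big1 ?rmorph0 // => i; rewrite mul0r.
  by rewrite big1 // => i _; rewrite rmorph0 scale0r.
- move=> _ _ [a ->] [b ->]; exists (fun i => a i + b i); congr (_, _).
    by rewrite -rmorphD -big_split; congr (sigma _); apply: eq_bigr => i _; rewrite mulrDl.
  by rewrite -big_split; apply: eq_bigr => i _; rewrite rmorphD scalerDl.
- move=> s _ [a ->]; exists (fun i => s * a i); congr (_, _) => /=.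
    by rewrite -[LHS]rmorphM mulr_sumr; congr (sigma _); apply: eq_bigr => i _; rewrite mulrA.
  by rewrite scaler_sumr; apply: eq_bigr => i _; rewrite rmorphM scalerA.
- move=> z [a [/esym/(local_ker loc)[s [s0 Jsa]] ->]].
  apply: (local_cancel s0); rewrite scaler0; apply: to_dual_eq0.
  rewrite to_dualZ to_dual_sum.
  under eq_bigr do rewrite to_dualZ yP -actM.
  by rewrite -act_sum -actM dJ.
have gX i : sigma 'X_i *: g 1 = y i.
  rewrite -linearZ /=; apply: gP; exists (fun j => (j == i)%:R); congr (_, _).
    rewrite (bigD1 i) //= eqxx mul1r big1 ?addr0; first exact: mulr1.
    by move=> j /negPf ->; rewrite mul0r.
  rewrite (bigD1 i) //= eqxx rmorph1 scale1r big1 ?addr0 //.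
  by move=> j /negPf ->; rewrite rmorph0 scale0r.
exists (g 1 + sigma (d 0%MM - to_dual (g 1) 0%MM)%:MP *: u); apply/funext => m.
rewrite to_dualD to_dualZ -[RHS](subrK (to_dual (g 1) m)) addrC -[LHS]/(_ + _).
congr (_ + _); rewrite -[(_)%:MP]mulr1 mul_mpolyC -mpolyX0 act_monomial add0m to_dual_u.
have [->|m0] := eqVneq; first by rewrite mulr1.
have [i mi] := mnm_neq0_var m0.
rewrite mulr0; have mE : m = (U_(i) + (m - U_(i)))%MM by rewrite addmC submK // lep1mP.
have := congr1 (fun d' => d' (m - U_(i))%MM) (yP i).
rewrite -gX to_dualZ -['X_i]scale1r !act_monomial !mul1r -mE => ->.
by rewrite subrr.
Qed.

End Hull.

(** * Duality turns graded exact sequences into exact sequences *)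

Section DualExactness.
Variables (k : fieldType) (n : nat) (I J L : finType).
Local Notation S := {mpoly k[n]}.
Local Notation dual := ('X_{1..n} -> k).
Variables (M : I -> J -> S) (G : L -> J -> S).
Hypothesis G_gen : forall v, in_kernel M v ->
  exists a : L -> S, forall j, v j = \sum_l a l * G l j.
Variables (D : I -> nat) (tau : J -> nat).
Hypothesis M_graded : forall i j s,
  truncate (D i) (s * M i j) = truncate (tau j) s * M i j.
Variable d : J -> dual.
Hypothesis d_van : forall j, vanishes_from (tau j) (d j).
Hypothesis d_ker : forall l, \sum_j act (G l j) (d j) = 0.

Lemma pairing_suml (r : seq J) (F : J -> dual) s :
  pairing (\sum_(j <- r) F j) s = \sum_(j <- r) pairing (F j) s.
Proof.
elim/big_rec2: _ => [|j x y _ <-]; first exact: pairing_ext.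
by rewrite pairingDl.
Qed.

(** The functional u |-> sum_j <d_j, u_j> vanishes on the kernel of M by [d_ker], so
    it descends to the image of M. It can be prescribed to be 0 on the elements of
    high degree of the target too, because truncation commutes with M. *)
Lemma dual_graph : functional_graph
  [set vc : {ffun I -> S} * k^o | exists u : J -> S,
    (forall i, truncate (D i) (vc.1 i - \sum_j u j * M i j) = 0) /\
    vc.2 = \sum_j pairing (d j) (u j)].
Proof.
split; first split.
- exists (fun=> 0); split=> [i|]; last by rewrite big1 // => j _; rewrite pairing0.
  by rewrite big1 ?ffunE ?subr0 ?linear0 // => j _; rewrite mul0r.
- move=> a [v c] [v' c'] [u [/= uv ->]] [u' [/= uv' ->]].
  exists (fun j => a *: u j + u' j); split=> [i|] /=.
    have -> : (a *: v + v') i - \sum_j (a *: u j + u' j) * M i j =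
        a *: (v i - \sum_j u j * M i j) + (v' i - \sum_j u' j * M i j).
      rewrite !ffunE scalerBr addrACA -opprD scaler_sumr -big_split; congr (_ - _).
      by apply: eq_bigr => j _; rewrite mulrDl scalerAl.
    by rewrite linearP /= uv uv' scaler0 addr0.
  rewrite scaler_sumr -big_split; apply: eq_bigr => j _ /=.
  by rewrite pairingD pairingZ.
move=> c [u [/= uv ->]].
have [i|a aE] := G_gen (v := fun j => truncate (tau j) (u j)).
  have := uv i; rewrite ffunE sub0r linearN /= => /eqP.
  rewrite oppr_eq0 linear_sum => /eqP /= {2}<-; apply: eq_bigr => j _.
  by rewrite M_graded mulrC.
transitivity (\sum_l pairing (\sum_j act (G l j) (d j)) (a l)); last first.
  by rewrite big1 // => l _; rewrite d_ker; exact: pairing_ext.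
transitivity (\sum_j \sum_l pairing (act (G l j) (d j)) (a l)).
  apply: eq_bigr => j _; rewrite -(pairing_truncate _ (@d_van j)) aE.
  by rewrite pairing_sum; apply: eq_bigr => l _; rewrite pairing_act mulrC.
by rewrite exchange_big; apply: eq_bigr => l _; rewrite pairing_suml.
Qed.

(** If G generates the kernel of M, then a family [d] of inverse polynomials that is
    killed by the transpose of G comes from the transpose of M. The degree bounds
    [tau] and [D] keep the functionals finitely supported. *)
Lemma dual_exactness : exists z : I -> dual,
  (forall i, vanishes_from (D i) (z i)) /\
  forall j, d j = \sum_i act (M i j) (z i).
Proof.
have [g gP] := functional_extension dual_graph.
pose e i s : {ffun I -> S} := [ffun i' => if i' == i then s else 0].
have e_lin i : linear (e i).
  move=> a s t; apply/ffunP => i'; rewrite !ffunE.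
  by case: ifP => _; rewrite ?scaler0 ?addr0.
pose ge i := HB.pack_for {linear S -> k^o} (g \o e i) (GRing.isLinear.Build k S k^o *:%R (g \o e i)
  (fun a s t => etrans (congr1 g (e_lin i a s t)) (linearP g a (e i s) (e i t)))).
pose z i : dual := fun m => g (e i 'X_[m]).
have gz i s : g (e i s) = pairing (z i) s.
  apply: (@linear_mpoly_ext k n k^o (ge i) (pairing (z i))) => m /=.
  by rewrite pairingX.
exists z; split=> [i m Dm|j].
  apply: gP; exists (fun=> 0); split=> [i'|] /=; last by rewrite big1 // => j _; rewrite pairing0.
  rewrite big1 ?subr0 => [|j _]; last by rewrite mul0r.
  rewrite ffunE; case: eqP => [->|_]; last by rewrite linear0.
  by rewrite truncateX ltnNge Dm.
apply/funext => m.
have gv : g [ffun i => 'X_[m] * M i j] = d j m.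
  apply: gP; exists (fun j' => if j' == j then 'X_[m] else 0); split=> [i|] /=.
    rewrite ffunE (bigD1 j) //= eqxx big1 ?addr0 ?subrr ?linear0 // => j' /negPf ->.
    by rewrite mul0r.
  rewrite (bigD1 j) //= eqxx pairingX big1 ?addr0 // => j' /negPf ->.
  exact: pairing0.
rewrite -gv fct_sumE.
rewrite [X in g X](_ : _ = \sum_i e i ('X_[m] * M i j)); last first.
  apply/ffunP => i; rewrite sum_ffunE ffunE (bigD1 i) //= ffunE eqxx big1 ?addr0 // => i' i'i.
  by rewrite ffunE eq_sym (negPf i'i).
by rewrite linear_sum; apply: eq_bigr => i _; rewrite gz mulrC.
Qed.

End DualExactness.

(** * The Frobenius map on inverse polynomials *)

Lemma frobenius_add (A : comNzRingType) (p e : nat) : p \in [pchar A] ->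
  forall x y : A, (x + y) ^+ (p ^ e) = x ^+ (p ^ e) + y ^+ (p ^ e).
Proof.
move=> charA x y; apply: exprDn_pchar.
by rewrite (eq_pnat _ (pcharf_eq charA)) pnatX pnat_id ?(pcharf_prime charA).
Qed.

Section FrobeniusBasis.
Variables (k : fieldType) (p e : nat).
Hypotheses (charkp : p \in [pchar k]) (kF : finite_p_degree k p).

Let frobD := frobenius_add e charkp.

Lemma frobenius_opp (x : k) : (- x) ^+ (p ^ e) = - x ^+ (p ^ e).
Proof.
apply/eqP; rewrite -addr_eq0 -frobD addNr expr0n gtn_eqF //.
by rewrite expn_gt0 prime_gt0 ?(pcharf_prime charkp).
Qed.

(** If k is spanned over k^p by the b_i and over k^(p^e) by the b'_j, then it is
    spanned over k^(p^(e+1)) by the products (b'_j)^p b_i. *)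
Lemma frobenius_spanning_set : exists N (b : 'I_N -> k),
  forall x, exists c : 'I_N -> k, x = \sum_i c i ^+ (p ^ e) * b i.
Proof.
have [d [b0 b0P]] := kF.
suff [I [b bP]] : exists (I : finType) (b : I -> k),
    forall x, exists c : I -> k, x = \sum_i c i ^+ (p ^ e) * b i.
  exists #|I|, (b \o enum_val) => x; have [c ->] := bP x; exists (c \o enum_val).
  by rewrite (reindex (@enum_val _ (mem I))) //; apply: onW_bij; exact: enum_val_bij.
elim: e => [|e' [I [b bP]]].
  by exists unit, (fun=> 1) => x; exists (fun=> x); rewrite big_const card_unit /= mulr1 addr0.
exists (I * 'I_d)%type, (fun ij => b ij.1 ^+ p * b0 ij.2) => x.
have [c ->] := b0P x.
have /choice[c' c'P] : forall i, exists c' : I -> k, c i = \sum_j c' j ^+ (p ^ e') * b j.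
  by move=> i; exact: bP.
exists (fun ij => c' ij.2 ij.1).
rewrite -(pair_bigA _ (fun i j => c' j i ^+ (p ^ e'.+1) * (b i ^+ p * b0 j))) /=.
rewrite exchange_big; apply: eq_bigr => j _ /=; rewrite c'P.
have := rmorph_sum (pFrobenius_aut charkp) (index_enum I) xpredT
  (fun i => c' j i ^+ (p ^ e') * b i).
rewrite /= pFrobenius_autE => ->; rewrite mulr_suml; apply: eq_bigr => i _.
by rewrite pFrobenius_autE exprMn -exprM -expnSr mulrA.
Qed.

(** A spanning family of minimal size is linearly independent over the q-th powers,
    so that coordinates are unique, hence additive and q-th root linear. *)
Lemma frobenius_coordinates : exists N (b : 'I_N -> k) (kap : 'I_N -> k -> k),
  [/\ forall x, x = \sum_j kap j x ^+ (p ^ e) * b j,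
      forall j x y, kap j (x + y) = kap j x + kap j y &
      forall j c x, kap j (c ^+ (p ^ e) * x) = c * kap j x].
Proof.
pose spans N := `[< exists b : 'I_N -> k,
  forall x, exists c : 'I_N -> k, x = \sum_i c i ^+ (p ^ e) * b i >].
have exN : exists N, spans N by have [N bP] := frobenius_spanning_set; exists N; apply/asboolP.
have [N /asboolP[b bP] minN] := ex_minnP exN.
have indep (c : 'I_N -> k) : \sum_j c j ^+ (p ^ e) * b j = 0 -> forall j, c j = 0.
  move=> cb j; apply/eqP; apply: contraT => cj.
  case: N b bP minN c cb j cj => [|N] b bP minN c cb j cj; first by case: j cj.
  suff /minN : spans N by rewrite ltnn.
  apply/asboolP; exists (b \o lift j) => x; have [a ->] := bP x.
  (* The relation with coefficients c allows to eliminate b j. *)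
  exists (fun i => a (lift j i) - a j / c j * c (lift j i)).
  rewrite -[LHS]subr0 -[X in _ - X](mulr0 ((a j / c j) ^+ (p ^ e))) -[X in _ * X]cb.
  rewrite mulr_sumr -sumrB (bigD1_ord j) //= mulrA -exprMn divfK // subrr add0r.
  by apply: eq_bigr => i _; rewrite frobD frobenius_opp mulrBl mulrA -exprMn.
have uniq (c c' : 'I_N -> k) :
    \sum_j c j ^+ (p ^ e) * b j = \sum_j c' j ^+ (p ^ e) * b j -> forall j, c j = c' j.
  move=> cc' j; apply/eqP; rewrite -subr_eq0; apply/eqP.
  apply: (indep (fun j => c j - c' j)); apply/eqP; move/eqP: cc'; rewrite -subr_eq0 -sumrB.
  rewrite (eq_bigr (fun j => (c j - c' j) ^+ (p ^ e) * b j)) // => i _.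
  by rewrite frobD frobenius_opp mulrBl.
have [kap kapP] := choice bP.
exists N, b, (fun j x => kap x j); split=> // [j x y|j c x].
  apply: (uniq _ (fun j => kap x j + kap y j)); rewrite -kapP [in LHS](kapP x) [in LHS](kapP y).
  by rewrite -big_split; apply: eq_bigr => i _; rewrite frobD mulrDl.
apply: (uniq _ (fun j => c * kap x j)); rewrite -kapP [in LHS](kapP x) mulr_sumr.
by apply: eq_bigr => i _; rewrite exprMn mulrA.
Qed.

End FrobeniusBasis.

Section FrobeniusDual.
Variables (k : fieldType) (n q : nat).
Hypotheses (q_gt0 : (0 < q)%N)
  (frobD : forall x y : k, (x + y) ^+ q = x ^+ q + y ^+ q)
  (frobSD : forall s t : {mpoly k[n]}, (s + t) ^+ q = s ^+ q + t ^+ q).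
Local Notation S := {mpoly k[n]}.
Local Notation dual := ('X_{1..n} -> k).
Implicit Types (d : dual) (s : S).

(** In the notation of inverse monomials x^(-m-1), this is the q-th power map: the
    exponent m + 1 is multiplied by q, hence the shift by one. *)
Definition frobenius_dual d : dual := fun m =>
  if [forall i, (q %| (m i).+1)%N]
  then d [multinom ((m i).+1 %/ q).-1 | i < n] ^+ q else 0.

Lemma frobenius_dual0 : frobenius_dual 0 = 0.
Proof. by apply/funext => m; rewrite /frobenius_dual expr0n gtn_eqF // if_same. Qed.

Lemma frobenius_dualD d d' :
  frobenius_dual (d + d') = frobenius_dual d + frobenius_dual d'.
Proof.
apply/funext => m; rewrite -[RHS]/(frobenius_dual d m + frobenius_dual d' m).
by rewrite /frobenius_dual; case: ifP => _; rewrite ?addr0 // -frobD.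
Qed.

Lemma frobenius_dual_vanishes t d :
  vanishes_from t d -> vanishes_from (q * (t + n)) (frobenius_dual d).
Proof.
move=> dt m tm; rewrite /frobenius_dual; case: ifP => // /forallP mq.
rewrite dt ?expr0n ?gtn_eqF // -(leq_add2r n) -(leq_pmul2l q_gt0).
apply: leq_trans tm _; rewrite !mdegE -[X in (_ + X)%N]card_ord -sum1_card -big_split.
rewrite big_distrr; apply: leq_sum => i _; rewrite mnmE /= addn1.
case/dvdnP: (mq i) => -[|x] // mE; rewrite mE mulnK //= mulnC -mE; exact: leqnSn.
Qed.

Lemma frobenius_dual_act s d :
  frobenius_dual (act s d) = act (s ^+ q) (frobenius_dual d).
Proof.
elim/mpolyind: s => [|c m s _ _ IHs].
  by rewrite expr0n gtn_eqF // !act0l frobenius_dual0.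
rewrite actDl frobenius_dualD IHs frobSD actDl; congr (_ + _).
rewrite exprZn mpolyXn; apply/funext => m'; rewrite act_monomial /frobenius_dual.
have -> : [forall i, (q %| ((m *+ q + m')%MM i).+1)%N] = [forall i, (q %| (m' i).+1)%N].
  by apply: eq_forallb => i; rewrite mnmDE mulmnE -addnS dvdn_addr ?dvdn_mull.
case: ifP => [/forallP m'q|_]; last by rewrite mulr0.
rewrite act_monomial exprMn; congr (_ * d _ ^+ _); apply/mnmP => i.
rewrite mnmDE !mnmE mulmnE -addnS divnMDl //.
have : (0 < (m' i).+1 %/ q)%N by rewrite divn_gt0 // dvdn_leq.
by case: (_ %/ _)%N => // x _; rewrite addnS.
Qed.

Variables (N : nat) (b : 'I_N -> k) (kap : 'I_N -> k -> k).
Hypotheses (kapE : forall x, x = \sum_j kap j x ^+ q * b j)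
  (kapD : forall j x y, kap j (x + y) = kap j x + kap j y)
  (kapZ : forall j c x, kap j (c ^+ q * x) = c * kap j x).

Lemma kap0 j : kap j 0 = 0.
Proof. by apply: (addrI (kap j 0)); rewrite -kapD !addr0. Qed.

(** When [b] is a basis of k over the q-th powers, these form a basis of S over its
    subring of q-th powers. *)
Definition frobenius_digit (a : {ffun 'I_n -> 'I_q}) (j : 'I_N) : S :=
  b j *: 'X_[[multinom (a i : nat) | i < n]].

(** The coordinate of [d] on [frobenius_digit a j], when inverse polynomials are
    decomposed as combinations of the values of [frobenius_dual]. The index
    q m + (q - 1 - a) comes from the shift by one in [frobenius_dual]. *)
Definition frobenius_component (a : {ffun 'I_n -> 'I_q}) (j : 'I_N) d : dual :=
  fun m => kap j (d [multinom (q * m i + (q.-1 - a i))%N | i < n]).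

Lemma frobenius_component0 a j : frobenius_component a j 0 = 0.
Proof. by apply/funext => m; exact: kap0. Qed.

Lemma frobenius_componentD a j d d' : frobenius_component a j (d + d') =
  frobenius_component a j d + frobenius_component a j d'.
Proof. by apply/funext => m; exact: kapD. Qed.

Lemma frobenius_component_vanishes a j t d :
  vanishes_from t d -> vanishes_from t (frobenius_component a j d).
Proof.
move=> dt m tm; rewrite /frobenius_component dt ?kap0 //; apply: leq_trans tm _.
rewrite !mdegE; apply: leq_sum => i _; rewrite mnmE.
by apply: leq_trans (leq_pmull _ q_gt0) (leq_addr _ _).
Qed.

Lemma frobenius_component_act a j s d :
  frobenius_component a j (act (s ^+ q) d) = act s (frobenius_component a j d).
Proof.
elim/mpolyind: s => [|c m s _ _ IHs].
  by rewrite expr0n gtn_eqF // !act0l frobenius_component0.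
rewrite frobSD !actDl frobenius_componentD IHs; congr (_ + _).
apply/funext => m'; rewrite exprZn mpolyXn act_monomial /frobenius_component.
rewrite act_monomial kapZ; congr (_ * kap _ (d _)); apply/mnmP => i.
by rewrite mnmDE !mnmE mulmnE; ring.
Qed.

(** At a monomial [m] only the vector of digits a_i = q - 1 - (m_i mod q) contributes,
    and there the sum over [j] is the decomposition of the scalar [d m]. *)
Lemma frobenius_decomposition d :
  d = \sum_a \sum_j act (frobenius_digit a j) (frobenius_dual (frobenius_component a j d)).
Proof.
apply/funext => m; rewrite fct_sumE.
pose a0 : {ffun 'I_n -> 'I_q} :=
  [ffun i => Ordinal (ltn_pmod (q.-1 - m i %% q) q_gt0)].
have mq i : (m i %% q <= q.-1)%N by rewrite -ltnS prednK // ltn_pmod.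
have a0E i : a0 i = (q.-1 - m i %% q)%N :> nat.
  by rewrite ffunE /= modn_small // -[X in (_ < X)%N](prednK q_gt0) ltnS leq_subr.
rewrite (bigD1 a0) //= [X in _ + X]big1 ?addr0 => [|a aa0].
  rewrite fct_sumE [LHS]kapE; apply: eq_bigr => j _.
  rewrite act_monomial /frobenius_dual.
  have sumE i : (([multinom (a0 i : nat) | i < n] + m)%MM i).+1 = (q * (m i %/ q).+1)%N.
    rewrite mnmDE mnmE a0E [X in (_ + X)%N](divn_eq (m i) q).
    have := mq i; move: (m i %% q)%N (m i %/ q)%N => r x rq.
    have -> : (q.-1 - r + (x * q + r)).+1 = (q.-1.+1 + x * q)%N by lia.
    by rewrite prednK // mulnS mulnC.
  rewrite ifT; last by apply/forallP => i; rewrite sumE dvdn_mulr.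
  rewrite [LHS]mulrC; congr (_ * _); rewrite /frobenius_component.
  congr (kap j (d _) ^+ q).
  apply/mnmP => i; rewrite [RHS]mnmE mnmE sumE mulKn // a0E /= subKn //.
  by rewrite mulnC -divn_eq.
rewrite fct_sumE big1 // => j _; rewrite act_monomial /frobenius_dual ifF ?mulr0 //.
apply/negP => /forallP aq; case/eqP: aa0; apply/ffunP => i; apply: val_inj => /=.
rewrite a0E; have := aq i; rewrite mnmDE mnmE -addnS.
have := ltn_ord (a i); move: (a i : nat) (mq i) => x.
rewrite {2}(divn_eq (m i) q) -addnS addnCA dvdn_addr ?dvdn_mull // addnS.
move: (m i %% q)%N => r rq xq /dvdnP[[|[|y]]]; rewrite ?mul0n ?mul1n ?mulSn; lia.
Qed.

Lemma frobenius_component_frobenius a j c m d :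
  frobenius_component a j (act (c *: 'X_[m]) (frobenius_dual d)) =
  if [forall i, a i == (m i %% q)%N :> nat]
  then act (kap j c *: 'X_[[multinom (m i %/ q)%N | i < n]]) d else 0.
Proof.
apply/funext => m'; rewrite /frobenius_component act_monomial /frobenius_dual.
have sumE i : ((m + [multinom (q * m' i + (q.-1 - a i))%N | i < n])%MM i + (a i : nat)).+1 =
    (q * (m i %/ q + m' i).+1 + m i %% q)%N.
  rewrite mnmDE mnmE [X in (X + _ + _).+1%N](divn_eq (m i) q).
  have := ltn_ord (a i); move: (m i %/ q)%N (m i %% q)%N (a i : nat) => x r y yq.
  have -> : (x * q + r + (q * m' i + (q.-1 - y)) + y).+1 = (q.-1.+1 + q * (x + m' i) + r)%N.
    by rewrite mulnDr [(q * x)%N]mulnC; lia.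
  by rewrite prednK // mulnS.
have -> : [forall i, (q %| ((m + [multinom (q * m' i + (q.-1 - a i))%N | i < n])%MM i).+1)%N] =
    [forall i, a i == (m i %% q)%N :> nat].
  apply: eq_forallb => i; have := sumE i; rewrite -addSn.
  move: ((_ + _)%MM i).+1 => w wE; apply/idP/eqP => [qw|ai].
    have : (w + a i = m i %[mod q])%N.
      by rewrite wE mulnC modnMDl modn_mod.
    by case/dvdnP: qw => w' ->; rewrite modnMDl modn_small.
  by move: wE; rewrite ai => /addIn ->; rewrite dvdn_mulr.
case: ifP => [/forallP am|_]; last by rewrite mulr0 kap0.
rewrite act_monomial mulrC kapZ mulrC; congr (_ * d _); apply/mnmP => i.
rewrite mnmDE !mnmE; have := sumE i; rewrite (eqP (am i)) -addSn => /addIn.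
by rewrite mnmDE mnmE (eqP (am i)) => ->; rewrite mulKn.
Qed.

End FrobeniusDual.

(** * Generators of the Frobenius operators *)

Definition power_linear (R : comNzRingType) (E : lmodType R) (q : nat) (f : E -> E) : Prop :=
  forall (a : R) x y, f (a *: x + y) = a ^+ q *: f x + f y.

Lemma power_linear0 (R : comNzRingType) (E : lmodType R) (q : nat)
    (h : E -> E) :
  power_linear q h -> h 0 = 0.
Proof.
move=> h_lin; have := h_lin 1 0 0; rewrite expr1n !scale1r addr0 => /eqP.
by rewrite -subr_eq0 opprD addNKr oppr_eq0 => /eqP.
Qed.

(** The kernel of this matrix consists of the (s, c) such that, for each [i],
    f_i s + sum_j c_ij f_j^q = 0; the column [None] corresponds to s. The entries
    s are the elements of the colon ideal of (f_1^q, ..., f_r^q) by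
    (f_1, ..., f_r). *)
Definition colon_matrix (A : comNzRingType) (r q : nat) (f : 'I_r -> A)
    (i : 'I_r) (c : option ('I_r * 'I_r)) : A :=
  if c is Some ji then (if ji.1 == i then f ji.2 ^+ q else 0) else f i.

Section FrobeniusOperators.
Variables (k : fieldType) (n : nat) (J : set {mpoly k[n]}).
Variables (R : comUnitRingType) (sigma : {rmorphism {mpoly k[n]} -> R}).
Hypothesis loc : localizes_at_origin J sigma.
Variables (E : lmodType R) (u : E).
Hypothesis soc : socle_generator sigma u.
Hypothesis E_inj : injective_module E.
Variables (p e : nat).
Hypotheses (charkp : p \in [pchar k]) (kF : finite_p_degree k p).
Variables (r : nat) (f : 'I_r -> {mpoly k[n]}) (delta : 'I_r -> nat).
Hypotheses (f_homog : forall i, f i \is (delta i).-homog)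
  (f_J : forall i, J (f i))
  (f_gen : forall K, is_ideal K -> (forall i, K (f i)) -> J `<=` K).
Local Notation S := {mpoly k[n]}.
Local Notation dual := ('X_{1..n} -> k).
Local Notation q := (p ^ e)%N.

Let q_gt0 : (0 < q)%N.
Proof. by rewrite expn_gt0 prime_gt0 ?(pcharf_prime charkp). Qed.
Let charSp : p \in [pchar S]. Proof. exact: (rmorph_pchar (@mpolyC n k)). Qed.
Let frobD := frobenius_add e charkp.
Let frobSD := frobenius_add e charSp.

Lemma killed_by_generators d : (forall i, act (f i) d = 0) -> forall a, J a -> act a d = 0.
Proof.
move=> fd; apply: (f_gen (K := [set a | act a d = 0])) => //.
split=> [|a x y xd yd]; first exact: act0l.
exact: annihilator_ideal.
Qed.

(** [dual_exactness] for the colon matrix, applied to the family equal to [d] in the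
    column [None] and to zero elsewhere: the equations of the column [None] express
    [d] by the [z i], those of the other columns say that the [z i] are killed by
    the f_j^q. *)
Lemma colon_exactness (L : finType) (G : L -> option ('I_r * 'I_r) -> S) (t : nat) d :
    (forall v, in_kernel (colon_matrix q f) v ->
       exists a : L -> S, forall c, v c = \sum_l a l * G l c) ->
    vanishes_from t d -> (forall l, act (G l None) d = 0) ->
  exists z : 'I_r -> dual,
    [/\ forall i, exists t', vanishes_from t' (z i),
        d = \sum_i act (f i) (z i) &
        forall i j, act (f j ^+ q) (z i) = 0].
Proof.
move=> G_gen dt Gd.
pose D i := (t + delta i)%N.
pose tau (c : option ('I_r * 'I_r)) :=
  if c is Some ji then (D ji.1 - delta ji.2 * q)%N else t.
pose d' (c : option ('I_r * 'I_r)) : dual := if c is Some _ then 0 else d.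
have [||l|z [zD dz]] := @dual_exactness k n _ _ L _ G G_gen D tau _ d'.
- move=> i [[j j']|] s /=; last first.
    by rewrite (truncateM _ _ (f_homog i)) /D addnK.
  case: eqP => [->|_]; last by rewrite !mulr0 linear0.
  by rewrite (truncateM _ _ (dhomogMn q (f_homog j'))).
- by move=> [ji|] m //= tm; apply: dt.
- rewrite (bigD1 None) //= Gd add0r big1 // => -[ji|] //= _; exact: act0.
exists z; split=> [i||i j]; first by exists (D i).
  exact: (dz None).
have := dz (Some (i, j)); rewrite /d' /= (bigD1 i) //= eqxx big1 ?addr0 //.
by move=> i'; rewrite eq_sym => /negPf ->; exact: act0l.
Qed.

Variable lam : E -> k.
Hypothesis lamD : forall x y, lam (x + y) = lam x + lam y.
Hypothesis lamZ : forall c x, lam (sigma c%:MP *: x) = c * lam x.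
Hypothesis lam_u : lam u = 1.
Local Notation to_dual := (to_dual sigma lam).
Local Notation frob := (frobenius_dual q).

Lemma power_linearZ (h : E -> E) s x : power_linear q h -> h (sigma s *: x) = sigma (s ^+ q) *: h x.
Proof.
move=> h_lin; have := h_lin (sigma s) x 0.
by rewrite (power_linear0 h_lin) !addr0 rmorphXn.
Qed.

Lemma power_linearD (h : E -> E) x y : power_linear q h -> h (x + y) = h x + h y.
Proof. by move=> h_lin; have := h_lin 1 x y; rewrite expr1n !scale1r. Qed.

Section Lift.
Variables (N : nat) (b : 'I_N -> k) (kap : 'I_N -> k -> k).
Hypotheses (kapE : forall x, x = \sum_j kap j x ^+ q * b j)
  (kapD : forall j x y, kap j (x + y) = kap j x + kap j y)
  (kapZ : forall j c x, kap j (c ^+ q * x) = c * kap j x).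
Local Notation digit := (frobenius_digit b).
Local Notation component := (frobenius_component kap).
Variable h : E -> E.
Hypothesis h_lin : power_linear q h.

(** The graph of the unique S-linear map on inverse polynomials annihilated by the
    f_i^q that sends F(x) to h(x), computed on the decomposition of [d] along the
    basis of S over its q-th powers. *)
Definition lifts (d : dual) (y : E) : Prop :=
  exists x : {ffun 'I_n -> 'I_q} -> 'I_N -> E,
    (forall a j, to_dual (x a j) = component a j d) /\
    y = \sum_a \sum_j sigma (digit a j) *: h (x a j).

Lemma lifts_fun d y y' : lifts d y -> lifts d y' -> y = y'.
Proof.
move=> [x [xd ->]] [x' [x'd ->]]; apply: eq_bigr => a _; apply: eq_bigr => j _.
have -> // : x a j = x' a j.
by apply: (to_dual_inj soc lamD lamZ lam_u); rewrite xd x'd.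
Qed.

Lemma lifts0 : lifts 0 0.
Proof.
exists (fun _ _ => 0); split=> [a j|].
  by rewrite frobenius_component0 // to_dual0.
rewrite big1 // => a _; rewrite big1 // => j _.
by rewrite (power_linear0 h_lin) scaler0.
Qed.

Lemma liftsD d d' y y' : lifts d y -> lifts d' y' -> lifts (d + d') (y + y').
Proof.
move=> [x [xd ->]] [x' [x'd ->]]; exists (fun a j => x a j + x' a j); split=> [a j|].
  by rewrite frobenius_componentD // to_dualD // xd x'd.
rewrite -big_split; apply: eq_bigr => a _; rewrite -big_split; apply: eq_bigr => j _.
by rewrite power_linearD // scalerDr.
Qed.

Lemma lifts_sum (I : Type) (s : seq I) (d : I -> dual) (y : I -> E) :
  (forall i, lifts (d i) (y i)) -> lifts (\sum_(i <- s) d i) (\sum_(i <- s) y i).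
Proof.
move=> dy; elim/big_rec2: _ => [|i y' d' _]; first exact: lifts0.
exact: liftsD.
Qed.

(** For a monomial s = c X^m, the element s F(x) has components only at the digits
    a = m mod q, and m = a + q (m div q) recombines them into s h(x). *)
Lemma lifts_frobenius s x : lifts (act s (frob (to_dual x))) (sigma s *: h x).
Proof.
elim/mpolyind: s => [|c m s _ _ IHs].
  by rewrite act0l rmorph0 scale0r; exact: lifts0.
rewrite actDl rmorphD scalerDl; apply: liftsD => //.
pose m' := [multinom (m i %/ q)%N | i < n].
exists (fun (a : {ffun 'I_n -> 'I_q}) j => if [forall i, a i == (m i %% q)%N :> nat]
                  then sigma (kap j c *: 'X_[m']) *: x else 0); split=> [a j|].
  rewrite frobenius_component_frobenius //; case: ifP => _; last exact: to_dual0.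
  by rewrite (to_dualZ lamD lamZ).
pose a0 : {ffun 'I_n -> 'I_q} := [ffun i => Ordinal (ltn_pmod (m i) q_gt0)].
rewrite (bigD1 a0) //= [X in _ + X]big1 ?addr0 => [|a aa0]; last first.
  rewrite big1 // => j _; rewrite ifF ?(power_linear0 h_lin) ?scaler0 //.
  apply/negP => /forallP am; case/eqP: aa0; apply/ffunP => i; apply: val_inj.
  by rewrite ffunE /=; exact/eqP.
transitivity (\sum_j sigma (digit a0 j * (kap j c *: 'X_[m']) ^+ q) *: h x); last first.
  apply: eq_bigr => j _; rewrite ifT.
    by rewrite power_linearZ // scalerA -rmorphM.
  by apply/forallP => i; rewrite ffunE.
rewrite -scaler_suml -rmorph_sum; congr (sigma _ *: _).
rewrite [in LHS](kapE c) scaler_suml; apply: eq_bigr => j _.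
rewrite exprZn mpolyXn /frobenius_digit -scalerAl -scalerAr scalerA [b j * _]mulrC.
rewrite -mpolyXD; congr (_ *: 'X_[_]); apply/mnmP => i.
by rewrite mnmDE mulmnE !mnmE ffunE /= addnC -divn_eq.
Qed.

(** By the decomposition of [d] it suffices to treat elements of the form t F(x),
    where [lifts_frobenius] applies to both t and s t. *)
Lemma liftsZ s d y : lifts d y -> lifts (act s d) (sigma s *: y).
Proof.
move=> [x [xd ->]].
rewrite [d](frobenius_decomposition q_gt0 kapE) act_sumr scaler_sumr.
apply: lifts_sum => a; rewrite act_sumr scaler_sumr; apply: lifts_sum => j.
by rewrite -xd -actM scalerA -rmorphM; exact: lifts_frobenius.
Qed.

(** The components of [d] are killed by the f_i since taking components is S-linear
    along the Frobenius, so they come from E. *)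
Lemma lifts_ex t d : vanishes_from t d -> (forall i, act (f i ^+ q) d = 0) ->
  exists y, lifts d y.
Proof.
move=> dt fd.
have /choice[x xP] : forall aj : {ffun 'I_n -> 'I_q} * 'I_N,
    exists x, to_dual x = component aj.1 aj.2 d.
  move=> [a j] /=; apply: (to_dual_surj loc soc lamD lamZ lam_u E_inj (t := t)).
    exact: frobenius_component_vanishes.
  apply: killed_by_generators => i.
  by rewrite -frobenius_component_act // fd frobenius_component0.
exists (\sum_a \sum_j sigma (digit a j) *: h (x (a, j))), (fun a j => x (a, j)).
by split=> // a j; exact: (xP (a, j)).
Qed.

End Lift.

(** Semilinearity over S implies semilinearity over R because the denominators act
    injectively. *)
Lemma power_linear_of_polynomials (w : E -> E) :
  (forall x y, w (x + y) = w x + w y) ->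
  (forall s x, w (sigma s *: x) = sigma (s ^+ q) *: w x) -> power_linear q w.
Proof.
move=> wD wZ a x y; rewrite wD; congr (_ + _).
have [s [b [s0 sa]]] := local_frac loc a.
apply: (local_cancel loc (s := s ^+ q)).
  have -> : (s ^+ q)@_0%MM = s@_0%MM ^+ q by exact: (rmorphXn (mcoeff 0%MM)).
  by rewrite expf_neq0.
by rewrite -wZ scalerA sa wZ scalerA !rmorphXn /= -exprMn sa.
Qed.

(** The generators are x |-> s_l F(x), where the s_l are the entries [None] of the
    generators of the kernel. The graph [U] below is that of the map
    (s_l d)_l |-> (value at d of the lift of h), for d annihilated by the f_i^q; it
    is single valued by [colon_exactness], and it contains ((s_l F(x))_l, h(x)). *)
Lemma frobenius_operators_generated (g : nat) :
    kernel_generators (colon_matrix q f) g ->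
  exists (L : finType) (w : L -> E -> E),
    [/\ (#|L| <= g)%N, forall l, power_linear q (w l) &
        forall h, power_linear q h ->
          exists hl : L -> E -> E, (forall l, linear (hl l)) /\
            forall x, h x = \sum_l hl l (w l x)].
Proof.
move=> [L [G [Lg kerG genG]]].
(* f_i s_l = - sum_j c_ij f_j^q, and f_j^q F(d) = F(f_j d). *)
have G_frob l i d : (forall j, act (f j) d = 0) ->
    act (f i * G l None) (frob d) = 0.
  move=> fd; have /eqP := kerG l i; rewrite (bigD1 None) //= addr_eq0 => /eqP ->.
  rewrite -mulN1r actM act_sum big1 ?act0 // => -[[i' j]|] //= _.
  case: eqP => _; last by rewrite mul0r act0l.
  by rewrite mulrC actM -frobenius_dual_act // fd frobenius_dual0 // act0.
have /choice[w wP] : forall lx : L * E,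
    exists y, to_dual y = act (G lx.1 None) (frob (to_dual lx.2)).
  move=> [l x] /=; have [t xt] := to_dual_vanishes soc lamD x.
  apply: (to_dual_surj loc soc lamD lamZ lam_u E_inj (t := (q * (t + n))%N)).
    exact/vanishes_act/frobenius_dual_vanishes.
  apply: killed_by_generators => i; rewrite -actM; apply: G_frob => j.
  exact: (to_dual_ideal loc lamD lamZ x (f_J j)).
have w_lin l : power_linear q (fun x => w (l, x)).
  apply: power_linear_of_polynomials => [x y|s x].
    apply: (to_dual_inj soc lamD lamZ lam_u).
    by rewrite to_dualD // !wP /= to_dualD // frobenius_dualD // actDr.
  apply: (to_dual_inj soc lamD lamZ lam_u).
  rewrite (to_dualZ lamD lamZ) !wP /= (to_dualZ lamD lamZ) frobenius_dual_act //.
  by rewrite -!actM mulrC.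
exists L, (fun l x => w (l, x)); split=> // h h_lin.
have [N [b [kap [kapE kapD kapZ]]]] := frobenius_coordinates e charkp kF.
pose U := [set vy : {ffun L -> E} * E | exists t d,
  [/\ vanishes_from t d, forall i, act (f i ^+ q) d = 0,
      forall l, to_dual (vy.1 l) = act (G l None) d & lifts b kap h d vy.2]].
have [||||g' g'P] := @polynomial_graph_extension k n J R sigma loc E {ffun L -> E} E_inj U.
- exists 0%N, 0; split=> // [i|l|]; first exact: act0.
    by rewrite act0 ffunE to_dual0.
  exact: lifts0.
- move=> [v y] [v' y'] [t [d [dt fd vd dy]]] [t' [d' [d't fd' v'd d'y]]].
  exists (maxn t t'), (d + d'); split=> [m tm|i|l|].
  + rewrite -[LHS]/(d m + d' m) (vanishes_le (leq_maxl t t') dt tm).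
    by rewrite (vanishes_le (leq_maxr t t') d't tm) addr0.
  + by rewrite actDr fd fd' addr0.
  + by rewrite /= ffunE to_dualD // vd v'd actDr.
  + exact: liftsD.
- move=> s [v y] [t [d [dt fd vd dy]]]; exists t, (act s d); split=> [|i|l|].
  + exact: vanishes_act.
  + by rewrite -actM mulrC actM fd act0.
  + by rewrite /= ffunE (to_dualZ lamD lamZ) vd -!actM mulrC.
  + exact: liftsZ.
- move=> y [t [d [dt fd vd dy]]].
  have [|z [zt dz fz]] := colon_exactness genG dt.
    by move=> l; rewrite -vd /= ffunE to_dual0.
  have /choice[y' y'P] : forall i, exists y', lifts b kap h (z i) y'.
    by move=> i; have [t' zt'] := zt i; apply: lifts_ex zt' _ => //; exact: fz.
  apply: (lifts_fun dy); rewrite dz.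
  rewrite [X in lifts _ _ _ _ X](_ : 0 = \sum_i sigma (f i) *: y' i); last first.
    by rewrite big1 // => i _; rewrite (local_ideal loc (f_J i)) scale0r.
  by apply: lifts_sum => // i; exact: liftsZ.
pose inj l (y : E) : {ffun L -> E} := [ffun l' => if l' == l then y else 0].
exists (fun l y => g' (inj l y)); split=> [l a y y'|x].
  rewrite -linearP; congr (g' _); apply/ffunP => l'; rewrite !ffunE.
  by case: eqP => _; rewrite ?scaler0 ?addr0.
rewrite -linear_sum /=.
rewrite [X in g' X](_ : _ = [ffun l => w (l, x)]); last first.
  apply/ffunP => l; rewrite sum_ffunE !ffunE (bigD1 l) //= ffunE eqxx big1 ?addr0 // => l' l'l.
  by rewrite ffunE eq_sym (negPf l'l).
apply/esym/g'P; have [t xt] := to_dual_vanishes soc lamD x.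
exists (q * (t + n))%N, (frob (to_dual x)); split=> [|i|l|].
- exact: frobenius_dual_vanishes.
- by rewrite -frobenius_dual_act // (to_dual_ideal loc lamD lamZ _ (f_J i)) frobenius_dual0.
- by rewrite /= ffunE wP.
- have := lifts_frobenius kapE kapD kapZ h_lin 1 x.
  by rewrite act1 rmorph1 scale1r.
Qed.

End FrobeniusOperators.

(** * Complexity and the number of generators in each degree *)

Section Complexity.
Variables (A : gradedRing) (C b : nat).
Hypothesis b_gt0 : (0 < b)%N.
Hypothesis few_generators : forall e, exists s : seq A,
  homogeneous_generators e s /\ (size s <= C * b ^ e)%N.

Lemma min_generators_le e : exists m, min_generators A e m /\ (m <= C * b ^ e)%N.
Proof.
have [s [s_gen s_size]] := few_generators e.
pose P m := `[< exists s : seq A, homogeneous_generators e s /\ size s = m >].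
have exP : exists m, P m by exists (size s); apply/asboolP; exists s.
have [m /asboolP Pm minm] := ex_minnP exP.
exists m; split; first split=> // s' s'_gen.
  by apply: minm; apply/asboolP; exists s'.
by apply: leq_trans s_size; apply: minm; apply/asboolP; exists s.
Qed.

(** Both k_e and k_{e-1} are at least 0 and at most C b^e, hence so is the absolute
    value of their difference. *)
Lemma complexity_lt_pinfty (RR : realType) : (complexity A RR < +oo)%E.
Proof.
have /choice[g gP] := min_generators_le.
apply: (@le_lt_trans _ _ (b%:R : RR)%:E); last by rewrite ltry.
apply: ereal_inf_lbound; exists b%:R => //; split; first by rewrite ltr0n.
exists g; split; first by move=> e; case: (gP e).
have g_le e : (g e)%:R <= C%:R * b%:R ^+ e :> RR.
  by rewrite -natrX -natrM ler_nat; case: (gP e).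
have b1 : 1 <= b%:R :> RR by rewrite ler1n.
apply/eqOP; near=> K; near=> e.
rewrite [X in _ <= _ * X]ger0_norm ?exprn_ge0 ?ler0n //.
apply: (@le_trans _ _ (C%:R * b%:R ^+ e)).
  rewrite ler_norml; apply/andP; split.
    rewrite lerNl opprB lerBlDr -[leLHS]addr0 lerD ?ler0n //.
    apply: le_trans (g_le _) _; rewrite ler_wpM2l ?ler0n //.
    by apply: ler_weXn2l => //; exact: leq_pred.
  by apply: le_trans (g_le e); rewrite gerBl ler0n.
rewrite ler_wpM2r ?exprn_ge0 ?ler0n //.

Unshelve. all: by end_near.
Qed.

End Complexity.

Section FrobeniusRingGenerators.
Variables (R : comNzRingType) (p : nat) (charRp : p \in [pchar R]) (E : lmodType R).
Local Notation ops := (frobenius_ops charRp E).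
Local Notation ring := (frobenius_ring charRp E).

Lemma single_operator_ex i (h : E -> E) : power_linear (p ^ i) h ->
  exists g : ops, forall j x, g j x = if j == i then h x else 0.
Proof.
move=> h_lin.
have lin j : frobenius_operator charRp j (fun x => if j == i then h x else 0).
  apply/frobenius_operatorP => a x y.
  by have [->|_] := eqVneq j i; [exact: h_lin|rewrite scaler0 addr0].
have fin : exists N, forall j, (N <= j)%N -> forall x, (if j == i then h x else 0) = 0.
  by exists i.+1 => j ij x; rewrite gtn_eqF.
by exists (FrobeniusOps lin fin).
Qed.

Lemma sum_subring (A : pzRingType) (X : set A) (I : Type) (s : seq I) (F : I -> A) :
  is_subring X -> (forall i, X (F i)) -> X (\sum_(i <- s) F i).
Proof.
case=> X1 XB _ XF; have X0 : X 0 by rewrite -(subrr 1); exact: XB.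
elim/big_rec: _ => [|i y _ Xy]; first exact: X0.
rewrite -[y]opprK; apply: (XB (F i) (- y)); first exact: XF.
by rewrite -sub0r; exact: XB.
Qed.

Variables (B : nat -> nat).
Hypothesis generated : forall i, exists (L : finType) (w : L -> E -> E),
  [/\ (#|L| <= B i)%N, forall l, power_linear (p ^ i) (w l) &
      forall h, power_linear (p ^ i) h ->
        exists hl : L -> E -> E, (forall l, linear (hl l)) /\
          forall x, h x = \sum_l hl l (w l x)].

(** An operator of degree [i] equals sum_l h_l w_l in the ring, where the h_l have
    degree 0. *)
Lemma frobenius_part_generators i : exists s : seq ops,
  [/\ (size s <= B i)%N, forall g, g \in s -> frobenius_part i g &
      forall X : set ops, is_subring X -> frobenius_part 0 `<=` X ->
        (forall g, g \in s -> X g) -> frobenius_part i `<=` X].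
Proof.
have [L [w [LB w_lin w_gen]]] := generated i.
have /choice[W WP] l := single_operator_ex (w_lin l).
exists [seq W l | l <- enum L]; split; first by rewrite size_map -cardE.
  by move=> _ /mapP[l _ ->] j x ji; rewrite WP (negPf ji).
move=> X X_ring X0 XW g gi.
have g_lin : power_linear (p ^ i) (g i) by exact/frobenius_operatorP/fcoef_linear.
have [h [h_lin gE]] := w_gen _ g_lin.
have /choice[H HP] : forall l, exists g : ops, forall j x, g j x = if j == 0%N then h l x else 0.
  by move=> l; apply: single_operator_ex => a x y; rewrite expn0 expr1; exact: h_lin.
suff -> : g = \sum_l H l * W l.
  apply: sum_subring => // l; case: X_ring => _ _; apply.
    by apply: X0 => j x j0; rewrite HP (negPf j0).
  by apply: XW; rewrite map_f // mem_enum.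
have fcoef_bigsum (s : seq L) (F : L -> ops) j x :
    (\sum_(l <- s) F l) j x = \sum_(l <- s) F l j x.
  by elim/big_rec2: _ => // l y f _ <-.
apply: frobenius_opsP => j x; rewrite fcoef_bigsum.
transitivity (\sum_l if j == i then h l (w l x) else 0); last first.
  apply: eq_bigr => l _; rewrite [RHS](_ : _ = \sum_(a < j.+1) H l a (W l (j - a)%N x)) //.
  rewrite big_ord_recl /= HP eqxx subn0 WP big1 ?addr0 => [|a _]; last by rewrite HP.
  case: ifP => // _; apply/esym.
  by apply: (@power_linear0 _ _ 1) => a y z; rewrite expr1; exact: h_lin.
by have [->|ji] := eqVneq j i; [exact: gE|rewrite gi // big1].
Qed.

Lemma frobenius_ring_generators e : exists s : seq ring,
  homogeneous_generators e s /\ (size s <= \sum_(i < e.+1) B i)%N.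
Proof.
have /choice[F FP] := frobenius_part_generators.
exists (flatten [seq F i | i <- iota 0 e.+1]); split; last first.
  rewrite size_flatten sumnE /shape -map_comp big_map -(big_mkord xpredT B).
  by rewrite /index_iota subn0; apply: leq_sum => i _ /=; case: (FP i).
have sP (g : ops) : g \in flatten [seq F i | i <- iota 0 e.+1] ->
    exists2 i, (i <= e)%N & g \in F i.
  by move=> /flatten_mapP[i]; rewrite mem_iota add0n => ie gi; exists i.
split=> [g /sP[i _ gi]|]; first by exists i; case: (FP i) => _ + _; exact.
apply/seteqP; split.
  apply: sub_smallest2r.
    split=> [M [[M1 _ _] _] //|x y Xx Xy M MP|x y Xx Xy M MP].
      by case: (MP) => -[_ MB _] _; apply: MB; [exact: Xx|exact: Xy].
    by case: (MP) => -[_ _ MM] _; apply: MM; [exact: Xx|exact: Xy].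
  move=> g [g0|/= /sP[i ie gi]]; first by exists 0%N.
  by exists i; split=> //; case: (FP i) => _ + _; exact.
move=> g gE M [M_ring Ms]; apply: gE; split=> // h [i [ie hi]].
have [_ _] := FP i; apply; [exact: M_ring|..| exact: hi].
  by move=> x x0; apply: Ms; left.
move=> x xi; apply: Ms; right; apply/flatten_mapP; exists i => //.
by rewrite mem_iota.
Qed.

End FrobeniusRingGenerators.

(** * The local ring of a homogeneous ideal at the origin *)

Section HomogeneousIdeal.
Variables (k : fieldType) (n : nat) (J : idealr {mpoly k[n]}).
Hypothesis homJ : homogeneous_ideal J.
Local Notation S := {mpoly k[n]}.
Local Notation pi := (\pi_{ideal_quot J}%qT : S -> {ideal_quot J}).

Lemma idealr_is_ideal : is_ideal [set s : S | s \in J].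
Proof.
split=> [|a x y xJ yJ]; first exact: rpred0.
by apply: rpredD => //; exact: idealMr.
Qed.

(** The homogeneous components of a finite set of generators. *)
Lemma homogeneous_generators_ex : exists r (f : 'I_r -> S) (delta : 'I_r -> nat),
  [/\ forall i, f i \is (delta i).-homog, forall i, f i \in J &
      forall K, is_ideal K -> (forall i, K (f i)) -> [set s : S | s \in J] `<=` K].
Proof.
have [s [sJ s_gen]] := noetherian_mpoly idealr_is_ideal.
pose t := flatten [seq [seq (pihomog mdeg i g, i) | i <- iota 0 (msize g)] | g <- s].
exists (size t), (fun i => (nth (0, 0%N) t i).1), (fun i => (nth (0, 0%N) t i).2).
have tP x : x \in t -> x.1 \is (x.2).-homog /\ x.1 \in J.
  move=> /flatten_mapP[g gs /mapP[i _ ->]] /=; split; first exact: pihomogP.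
  by apply: homJ; exact: sJ.
split=> [i|i|K K_ideal tK]; [exact: (tP _ (mem_nth _ _)).1|exact: (tP _ (mem_nth _ _)).2|].
apply: s_gen => // g gs; rewrite (@pihomog_partitionE _ _ mdeg (msize g) g) //.
elim/big_rec: _ => [|i x _ Kx]; first exact: ideal0.
apply: idealD => //.
have gt : (pihomog mdeg i g, i : nat) \in t.
  apply/flatten_mapP; exists g => //; apply/mapP; exists (i : nat) => //.
  by rewrite mem_iota /=.
have it : (index (pihomog mdeg i g, i : nat) t < size t)%N by rewrite index_mem.
by have := tK (Ordinal it); rewrite /= nth_index.
Qed.

Lemma pi_eq0 s : pi s = 0 <-> s \in J.
Proof.
have := Quotient.idealrBE J s 0; rewrite subr0 => ->.
have pi0 : pi 0 = 0 by exact: rmorph0.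
by rewrite -pi0; split=> [/eqP|/eqP].
Qed.

(** Otherwise the component of degree 0 would be a unit in the proper ideal J. *)
Lemma constant_coefficient_eq0 s : s \in J -> s@_0%MM = 0.
Proof.
move=> sJ; apply/eqP; apply: contraT => s0.
have s0J : pihomog mdeg 0 s \in J by exact: homJ.
have sE : pihomog mdeg 0 s = (s@_0%MM)%:MP.
  rewrite pihomogE big_mkcond (bigD1_seq 0%MM) ?msupp_uniq ?mcoeff_msupp //=.
  rewrite mdeg0 eqxx mpolyX0 alg_mpolyC big1 ?addr0 // => m m0.
  by rewrite mdeg_eq0 (negPf m0).
have := idealr1 J; rewrite -(mpolyC1 n k) -(mulVf s0) mpolyCM -sE.
by rewrite idealMr.
Qed.

Lemma homogeneous_maximal_idealP s :
  homogeneous_maximal_ideal (pi s) <-> s@_0%MM = 0.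
Proof.
split=> [[c sc]|s0].
  have : pi (s - \sum_(i < n) repr (c i) * 'X_i) = 0.
    apply/eqP; rewrite rmorphB rmorph_sum subr_eq0; apply/eqP; rewrite [LHS]sc.
    by apply: eq_bigr => i _; rewrite rmorphM /= reprK.
  move=> /pi_eq0/constant_coefficient_eq0; rewrite mcoeffB raddf_sum /=.
  rewrite big1 ?subr0 // => i _.
  by rewrite mcoeff0M mcoeffX mnm1_eq0 mulr0.
rewrite (mpolyE s) rmorph_sum big_seq.
pose m := @homogeneous_maximal_ideal k n J.
have mM a b : m a -> m (b * a).
  move=> [c ->]; exists (fun i => b * c i); rewrite mulr_sumr.
  by apply: eq_bigr => i _; rewrite mulrA.
have mD a b : m a -> m b -> m (a + b).
  move=> [c ->] [d ->]; exists (fun i => c i + d i); rewrite -big_split.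
  by apply: eq_bigr => i _; rewrite mulrDl.
have mX i : m (pi 'X_i).
  exists (fun j => (j == i)%:R); rewrite (bigD1 i) //= eqxx mul1r big1 ?addr0 //.
  by move=> j /negPf ->; rewrite mul0r.
elim/big_rec: _ => [|m' x m's xm].
  by exists (fun=> 0); rewrite big1 // => i _; rewrite mul0r.
apply: mD => //; rewrite -mul_mpolyC rmorphM; apply: (mM).
have m'0 : m' != 0%MM by apply: contraTneq m's => ->; rewrite mcoeff_msupp s0 eqxx.
have [i mi] := mnm_neq0_var m'0.
by rewrite (mpolyX_var k mi) rmorphM; apply: mM; exact: mX.
Qed.

Variables (R : comUnitRingType) (phi : {rmorphism {ideal_quot J} -> R}).
Hypothesis locR : is_localization_at (@homogeneous_maximal_ideal k n J) phi.

Definition from_polynomials : {rmorphism S -> R} := phi \o \pi_{ideal_quot J}%qT.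
Local Notation sigma := from_polynomials.

Lemma localizes_at_origin_quotient : localizes_at_origin [set s : S | s \in J] sigma.
Proof.
have notm s : s@_0%MM != 0 -> ~ homogeneous_maximal_ideal (pi s).
  by move=> /eqP s0 /homogeneous_maximal_idealP.
have notmE (a : {ideal_quot J}) : ~ homogeneous_maximal_ideal a -> (repr a : S)@_0%MM != 0.
  move=> am; apply/eqP => a0; apply: am.
  by have := (homogeneous_maximal_idealP (repr a)).2 a0; rewrite /= reprK.
split=> [s /notm|r|a phia|a aJ].
- exact: (localization_unit locR).
- have [a [s [sm rE]]] := localization_frac locR r.
  exists (repr s), (repr a); split; first exact: notmE.
  rewrite /= !reprK rE mulrC divrK //; exact: (localization_unit locR).
- have [s [sm sa]] := localization_ker locR phia.
  exists (repr s); split; first exact: notmE.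
  by apply/pi_eq0; rewrite rmorphM /= reprK.
- by rewrite /=; have /pi_eq0 -> := aJ; exact: rmorph0.
Qed.

Variables (kappa : fieldType) (rho : {rmorphism R -> kappa}).
Hypothesis resR : is_residue_field rho.
Variables (E : lmodType R) (iota : {linear restrict_scalars rho kappa^o -> E}).
Hypothesis hullE : is_injective_hull iota.

(** An inverse of X_i would be a fraction a / s, and s - a X_i would then be killed
    by some t with nonzero constant term, although t (s - a X_i) has a nonzero
    constant term and so is not in J. *)
Lemma sigma_variable_nonunit i : sigma 'X_i \isn't a GRing.unit.
Proof.
apply/negP => Xu; have loc := localizes_at_origin_quotient.
have [s [a [s0 sa]]] := local_frac loc (sigma 'X_i)^-1.
have : sigma (s - a * 'X_i) = 0.
  by rewrite rmorphB rmorphM -sa -mulrA mulVr // mulr1 subrr.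
move=> /(local_ker loc)[t [t0 tJ]]; have := constant_coefficient_eq0 tJ.
rewrite mcoeff0M mcoeffB mcoeff0M mcoeffX mnm1_eq0 mulr0 subr0 => /eqP.
by rewrite mulf_eq0 (negPf t0) (negPf s0).
Qed.

Lemma residue_sigma s : rho (sigma s) = rho (sigma (s@_0%MM)%:MP).
Proof.
apply/eqP; rewrite -subr_eq0 -!rmorphB; apply/eqP.
have : (s - (s@_0%MM)%:MP)@_0%MM = 0 by rewrite mcoeffB mcoeffC eqxx mulr1 subrr.
move=> /homogeneous_maximal_idealP[c cE].
rewrite [sigma _](_ : _ = phi (pi (s - (s@_0%MM)%:MP))) // cE !rmorph_sum big1 // => i _.
rewrite !rmorphM; have /(residue_ker resR) := sigma_variable_nonunit i.
by move=> /= ->; rewrite mulr0.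
Qed.

(** A nonzero submodule R x meets the image of the residue field in some nonzero
    iota(c). Dividing by c gives iota(1) = w x with w in R; a denominator of w acts
    on iota(1) through its constant term, which can be divided out in S. *)
Lemma socle_generator_hull : socle_generator sigma (iota (1 : kappa^o)).
Proof.
have [_ [iota_inj iota_ess]] := hullE; have loc := localizes_at_origin_quotient.
have iota0 : iota 0 = 0 by exact: linear0.
have iotaZ (r : R) (y : kappa^o) : r *: iota y = iota (rho r * y : kappa^o).
  by rewrite -linearZ.
have iota1 : iota (1 : kappa^o) != 0.
  by apply/eqP; rewrite -iota0 => /iota_inj/eqP; rewrite oner_eq0.
split=> // [i|x x0].
  rewrite iotaZ; have /(residue_ker resR) -> := sigma_variable_nonunit i.
  by rewrite mul0r.
pose N := [set y : E | exists r : R, y = r *: x].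
have N_sub : is_submodule N.
  split; first by exists 0; rewrite scale0r.
  by move=> a _ _ [r ->] [r' ->]; exists (a * r + r'); rewrite scalerDl scalerA.
have [[y [Ny [c _ cy] y0]]|noy] := pselect (exists y, [/\ N y, range iota y & y != 0]); last first.
  have : N `&` range iota = [set 0].
    apply/seteqP; split=> y.
      move=> [Ny iy] /=; apply: contrapT => /eqP y0; by case: noy; exists y.
    by move=> ->; split; [exact: N_sub.1|exists 0].
  move=> /(iota_ess _ N_sub) N0; have : N x by exists 1; rewrite scale1r.
  by rewrite N0 => /eqP; rewrite (negPf x0).
have [r yE] := Ny; have c0 : (c : kappa) != 0.
  by apply: contra_neq y0 => c0; rewrite -cy c0.
have [z zc] := residue_surj resR (c^-1 : kappa).
have [s [a [s0 sa]]] := local_frac loc (z * r).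
exists ((s@_0%MM)^-1%:MP * a).
have sx : sigma a *: x = sigma (s@_0%MM)%:MP *: iota (1 : kappa^o).
  rewrite -sa -!scalerA -yE -cy !iotaZ residue_sigma zc mulVf //.
by rewrite rmorphM -scalerA sx scalerA -rmorphM -mpolyCM mulVf // rmorph1 scale1r.
Qed.

End HomogeneousIdeal.

(** * Finiteness of the Frobenius complexity *)

Lemma msize_exp_le (k : fieldType) (n : nat) (g : {mpoly k[n]}) (d q : nat) :
  (msize g <= d.+1)%N -> (msize (g ^+ q) <= (q * d).+1)%N.
Proof.
move=> gd; elim: q => [|q IHq]; first by rewrite expr0 msize1.
by rewrite exprS mulSn; exact: msize_mul_le.
Qed.

(** The number of rows and columns of the colon matrix is fixed, and its degrees
    grow linearly in [q]. *)
Lemma colon_kernel_generators (k : fieldType) (n r : nat) (f : 'I_r -> {mpoly k[n]}) :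
  exists C c : nat, forall q : nat, (0 < q)%N ->
    kernel_generators (colon_matrix q f) ((C * q) ^ c).
Proof.
have [c gen] := kernel_generators_polynomial k n.
pose d := (\sum_i msize (f i))%N.
have f_le i : (msize (f i) <= d)%N by rewrite /d (bigD1 i) //= leq_addr.
exists (r + r * r + d + 2)%N, c => q q0; set T := (_ * q)%N.
have CT : (r + r * r + d + 2 <= T)%N by exact: leq_pmulr.
have dT : ((q * d).+1 <= T)%N by rewrite /T mulnC; nia.
apply: gen => [|||i [[j l]|] /=].
- by apply: leq_trans CT; rewrite leq_addl.
- by rewrite card_ord; apply: leq_trans CT; lia.
- by rewrite card_option card_prod card_ord; apply: leq_trans CT; lia.
- case: ifP => _; last by rewrite msize0.
  apply: leq_trans dT; apply: msize_exp_le; exact: leqW.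
- by apply: leq_trans (f_le i) _; apply: leq_trans CT; lia.
Qed.

Lemma sum_power_le (C c p e : nat) : (0 < p)%N ->
  (\sum_(i < e.+1) (C * p ^ i) ^ c <= C ^ c * (2 * p ^ c) ^ e)%N.
Proof.
move=> p0; rewrite expnMn mulnCA -expnM mulnC [(c * e)%N]mulnC.
apply: (@leq_trans (\sum_(i < e.+1) C ^ c * p ^ (e * c))%N).
  apply: leq_sum => i _; rewrite expnMn -expnM leq_mul2l leq_pexp2l ?orbT //.
  by rewrite leq_mul2r -ltnS ltn_ord orbT.
by rewrite sum_nat_const card_ord mulnC leq_mul2l ltn_expl ?orbT.
Qed.

Theorem theorem1 (RR : realType) (k : fieldType) (p : nat)
    (charkp : p \in [pchar k]%R) (kF : finite_p_degree k p)
    (n : nat) (J : idealr {mpoly k[n]}) (homJ : homogeneous_ideal J)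
    (R : comUnitRingType) (phi : {rmorphism {ideal_quot J} -> R})
    (locR : is_localization_at (@homogeneous_maximal_ideal k n J) phi)
    (kappa : fieldType) (rho : {rmorphism R -> kappa})
    (resR : is_residue_field rho)
    (E : lmodType R)
    (iota : {linear restrict_scalars rho kappa^o -> E})
    (hullE : is_injective_hull iota) :
  (frobenius_complexity (pchar_transport phi charkp) E RR < +oo)%E.
Proof.
have p_pr := pcharf_prime charkp; have p0 := prime_gt0 p_pr.
have loc := localizes_at_origin_quotient homJ locR.
have soc := socle_generator_hull homJ locR resR hullE.
have [r [f [delta [f_hom f_J f_gen]]]] := homogeneous_generators_ex homJ.
have [C [c gen]] := colon_kernel_generators f.
have [lam [lamD lamZ lam_u]] := socle_functional_ex loc soc.
have pe i : (0 < p ^ i)%N by rewrite expn_gt0 p0.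
have few e := frobenius_ring_generators (pchar_transport phi charkp)
  (fun i => frobenius_operators_generated loc soc hullE.1 charkp kF f_hom f_J f_gen
     lamD lamZ lam_u (gen _ (pe i))) e.
have : (complexity (frobenius_ring (pchar_transport phi charkp) E) RR < +oo)%E.
  apply: (@complexity_lt_pinfty _ (C ^ c) (2 * p ^ c)).
    by rewrite muln_gt0 expn_gt0 p0.
  move=> e; have [s [s_gen s_size]] := few e; exists s; split=> //.
  exact: leq_trans s_size (sum_power_le C c e p0).
rewrite /frobenius_complexity.
have lnp : 0 < (ln (p%:R : RR))^-1 by rewrite invr_gt0 ln_gt0 // ltr1n prime_gt1.
case: (complexity _ _) => [x| |] //= _.
  by case: ifP => _; rewrite ?ltry // gt0_mulNye // lte_fin.
by rewrite gt0_mulNye // lte_fin.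
Qed.
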